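(* 1. There exists a constant $C=C(N)>0$ such that for any $\beta\geq 0$ the invariant probability measure $\mu^{\beta}$ satisfies $$\mu^{\beta}(\mathcal{L})\geq 1-Ce^{-\beta}.$$ 2. For any fixed $\delta>0$, $$\sup_{u\in\mathcal{S}\setminus\{\vec{0}\}}\mathbb{P}\Big(R^{\beta,u}(\mathcal{L})>e^{-\beta(1-\delta)}\Big)\to 0\quad\text{as }\beta\to+\infty.$$
   Context: Let $N\geq 3$, $\mathcal{A}=\{1,\dots,N\}$ (actors), $\mathcal{O}=\{-1,+1\}$ (opinions), and let $\beta\geq 0$ be the polarization coefficient. The state space is $$\mathcal{S}=\{u=(u(a):a\in\mathcal{A})\in\mathbb{Z}^N:\ \min\{|u(a)|:a\in\mathcal{A}\}=0\},$$ and $\vec{0}\in\mathcal{S}$ is the null list. For $a\in\mathcal{A}$, $\mathfrak{o}\in\mathcal{O}$ and a list $u$, define $\pi^{a,\mathfrak{o}}(u)(b)=u(b)+\mathfrak{o}$ if $b\neq a$, and $\pi^{a,\mathfrak{o}}(u)(a)=0$. For $u\in\mathcal{S}$, $(U_t^{\beta,u})_{t\in[0,+\infty)}$ is the Markov jump process on $\mathcal{S}$ started at $U_0^{\beta,u}=u$ which jumps from a list $v$ to $\pi^{a,\mathfrak{o}}(v)$ at rate $\exp(\beta\mathfrak{o}v(a))$, for each $(a,\mathfrak{o})\in\mathcal{A}\times\mathcal{O}$; i.e. its infinitesimal generator is $$\mathcal{G}f(v)=\sum_{\mathfrak{o}\in\mathcal{O}}\sum_{b\in\mathcal{A}}\exp(\beta\mathfrak{o}v(b))\,[f(\pi^{b,\mathfrak{o}}(v))-f(v)]$$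 for bounded $f:\mathcal{S}\to\mathbb{R}$. The process is non-explosive and has a unique invariant probability measure, denoted $\mu^{\beta}$. Ladder lists: $\mathcal{L}^+=\{u\in\mathcal{S}:\{u(1),\dots,u(N)\}=\{0,1,\dots,N-1\}\}$, $\mathcal{L}^-=\{u\in\mathcal{S}:\{u(1),\dots,u(N)\}=\{0,-1,\dots,-(N-1)\}\}$, $\mathcal{L}=\mathcal{L}^+\cup\mathcal{L}^-$. Hitting times: for $u\in\mathcal{S}$, $B\subset\mathcal{S}$, $R^{\beta,u}(B)=\inf\{t>0:U_t^{\beta,u}\in B\}$. *)

(* Defs.v *)
From HB Require Import structures.
From mathcomp Require Import all_boot all_order all_algebra.
From mathcomp Require Import all_classical all_reals all_analysis.

Set Implicit Arguments.
Unset Strict Implicit.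
Unset Printing Implicit Defensive.

Import Order.TTheory GRing.Theory Num.Theory.
Import numFieldNormedType.Exports.

Local Open Scope classical_set_scope.
Local Open Scope ring_scope.

(* Actors are 'I_N, numbered from 0; opinions are booleans, true for +1. *)
Definition opinion_val (o : bool) : int := if o then 1 else -1.

(* min_a |u a| = 0: the minimum of finitely many naturals is 0 iff one of them
   is. The bound on N is a parameter because a measurableType is inhabited. *)
Definition has_min_abs0 (N : nat) (u : {ffun 'I_N -> int}) : bool :=
  [exists a, `|u a|%N == 0%N].

Definition state (N : nat) (hN : (3 <= N)%N) : Type :=
  {u : {ffun 'I_N -> int} | has_min_abs0 u}.

HB.instance Definition _ N (hN : (3 <= N)%N) := Countable.on (state hN).

Lemma null_list_subproof (N : nat) (hN : (3 <= N)%N) :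
  has_min_abs0 ([ffun=> 0] : {ffun 'I_N -> int}).
Proof.
by apply/existsP; exists (Ordinal (ltn_trans (isT : 0 < 2)%N hN)); rewrite ffunE.
Qed.

Definition null_list (N : nat) (hN : (3 <= N)%N) : state hN :=
  exist _ [ffun=> 0] (null_list_subproof hN).

HB.instance Definition _ N (hN : (3 <= N)%N) :=
  isPointed.Build (state hN) (null_list hN).

HB.instance Definition _ N (hN : (3 <= N)%N) :=
  @isMeasurable.Build default_measure_display (state hN)
    discrete_measurable discrete_measurable0
    discrete_measurableC discrete_measurableU.

Definition express_list (N : nat) (a : 'I_N) (o : bool)
    (u : {ffun 'I_N -> int}) : {ffun 'I_N -> int} :=
  [ffun b => if b == a then 0 else u b + opinion_val o].

Lemma express_subproof (N : nat) (hN : (3 <= N)%N) (a : 'I_N) (o : bool)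
  (u : state hN) : has_min_abs0 (express_list a o (val u)).
Proof. by apply/existsP; exists a; rewrite ffunE eqxx. Qed.

(* The map pi^{a,o}. *)
Definition express (N : nat) (hN : (3 <= N)%N) (a : 'I_N) (o : bool)
    (u : state hN) : state hN :=
  exist _ (express_list a o (val u)) (express_subproof a o u).

Definition express_rate (R : realType) (beta : R) (N : nat) (hN : (3 <= N)%N)
    (a : 'I_N) (o : bool) (u : state hN) : R :=
  expR (beta * (opinion_val o * val u a)%:~R).

Definition pos_ladder (N : nat) (hN : (3 <= N)%N) : set (state hN) :=
  [set u : state hN | range (fun a => val u a) = [set k%:Z | k in `I_N]].
Arguments pos_ladder {N} hN _.

Definition neg_ladder (N : nat) (hN : (3 <= N)%N) : set (state hN) :=
  [set u : state hN | range (fun a => val u a) = [set - k%:Z | k in `I_N]].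
Arguments neg_ladder {N} hN _.

Definition ladder (N : nat) (hN : (3 <= N)%N) : set (state hN) :=
  pos_ladder hN `|` neg_ladder hN.
Arguments ladder {N} hN _.

Section jump_process.
Context {R : realType} {d d' : measure_display} {T : measurableType d'}.
Context {J : finType} (target : J -> T -> T) (rate : J -> T -> R).

Definition total_rate (x : T) : R := \sum_(j : J) rate j x.

(* Distinct marks may have the same target; their rates then add up. *)
Definition jump_prob (x y : T) : R :=
  (\sum_(j : J | target j x == y) rate j x) / total_rate x.

(* The non-explosive Markov jump process on a countable discrete space started
   at u that jumps from x to target j x at rate (rate j x), that is, with
   generator G f x = \sum_j rate j x * (f (target j x) - f x), described by its
   successive states Y and its holding times H. The last clause determines the
   joint law of (Y, H): Y is the Markov chain with transition matrix jump_prob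
   started at u and, given Y, the H i are independent and exponentially
   distributed with parameters total_rate (Y i). The n-th jump occurs at
   H 0 + ... + H n.-1; the clauses on paths hold surely, not merely almost
   surely, so that hitting times are measurable. *)
Definition is_jump_process (u : T) (Omega : measurableType d)
    (P : probability Omega R) (U : R -> Omega -> T) : Prop :=
  exists (Y : nat -> {RV P >-> T}) (H : nat -> {RV P >-> R}),
  [/\ forall n w, 0 < H n w,
      forall w, series (fun i => H i w) n @[n --> \oo] --> +oo,
      forall w n t,
        series (fun i => H i w) n <= t < series (fun i => H i w) n.+1 ->
        U t w = Y n w
    & forall (n : nat) (x : nat -> T) (t : nat -> R),
        (forall i, 0 <= t i) ->
        P [set w | (forall i, (i <= n)%N -> Y i w = x i) /\
                   (forall i, (i < n)%N -> t i < H i w)] =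
        ((x 0%N == u)%:R *
         \prod_(i < n) (expR (- total_rate (x i) * t i) *
                        jump_prob (x i) (x i.+1)))%:E].

End jump_process.

(* The law of U^{beta,u}, whose generator is
   G f v = \sum_(a, o) exp (beta * o * v a) * (f (pi^{a,o} v) - f v). *)
Definition is_opinion_process (R : realType) (beta : R) (N : nat)
    (hN : (3 <= N)%N) (u : state hN) (d : measure_display)
    (Omega : measurableType d) (P : probability Omega R)
    (U : R -> Omega -> state hN) : Prop :=
  is_jump_process
    (fun j : 'I_N * bool => @express N hN j.1 j.2)
    (fun j : 'I_N * bool => @express_rate R beta N hN j.1 j.2)
    u P U.

(* U u is the process started at u. *)
Definition invariant_measure (R : realType) (d d' : measure_display)
    (T : measurableType d') (Omega : T -> measurableType d)
    (P : forall u, probability (Omega u) R) (U : forall u, R -> Omega u -> T)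
    (mu : probability T R) : Prop :=
  forall (t : R) (B : set T), 0 <= t -> measurable B ->
    (\int[mu]_u P u [set w | B (U u t w)] = mu B)%E.

Definition hitting_time (R : realType) (Omega T : Type) (U : R -> Omega -> T)
    (B : set T) (w : Omega) : \bar R :=
  ereal_inf [set t%:E | t in [set t : R | 0 < t /\ B (U t w)]].

(* Main.v *)
Require Import Defs.
From HB Require Import structures.
From mathcomp Require Import all_boot all_order all_algebra.
From mathcomp Require Import all_classical all_reals all_analysis.
From mathcomp Require Import measurable_realfun zify ring lra.

Set Implicit Arguments.
Unset Strict Implicit.
Unset Printing Implicit Defensive.

Import Order.TTheory GRing.Theory Num.Theory.
Import numFieldNormedType.Exports.

Local Open Scope classical_set_scope.
Local Open Scope ring_scope.

(** Write x = expR (- beta). Call a move from the list u dominant when its rate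
    is the largest possible one, expR (beta * m) with m = max |u b|. The other
    moves are slower by a factor x at least, because the entries are integers.

    Combinatorics. Every sequence of dominant moves from a nonzero list, whatever
    the choices between ties, reaches a ladder list within 3 * N moves
    ([absorbed_neq_null]). Once t moves have been made, the entries that have
    been reset are smaller than t in absolute value; so after N moves at most, no
    entry exceeds N ([absorbed_reset]). From then on each dominant move decreases
    by 1 the smaller of the largest positive and the largest negative parts, until
    all entries have the same sign ([absorbed_one_sided]). For such a list N
    dominant moves reset the N actors in turn, and this produces a ladder
    ([absorbed_same_sign]). So the length [depth] of the longest dominant path to
    a ladder list is bounded, and each dominant move decreases it.

    Lyapunov function. [potential] is a multiple of [depth] times the order of
    magnitude of the time that one move takes: x ^+ N.-1 for the lists with
    distinct entries of one sign, where the largest entry is at least N - 1, and x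
    for the other nonzero lists, where it is at least 1; at the null list, where
    all the rates are 1, it is 1. For small x its generator is at most -1 off the
    ladder lists ([generator_off_ladder]), and at most of order x on them
    ([generator_ladder]): leaving a ladder list by a move of the ladder's sign has
    rate x ^- (N - 2) at most and costs a potential of order x ^+ (N - 1), and by a
    move of the opposite sign it has rate 1 at most and costs order x.

    Probability. For a jump process and a nonnegative function f such that
    lambda * r + G f <= lambda * f on a set D, with G the generator, the discounted
    reward r accumulated before leaving D has expectation at most f at the starting
    point ([integral_reward]); this follows from the Laplace transforms of the
    holding times along a path ([integral_discount_path]), by induction on the
    number of jumps. With r the indicator of the complement of the ladder lists,
    this bounds their discounted occupation, which for an invariant measure is
    their probability ([invariant_measure_le]): part 1, with lambda = x. With D
    that complement and r = 1, it bounds the tail of the hitting time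
    ([hitting_time_tail]): part 2, where the expected hitting time is of order x,
    to be compared with x to the power 1 - delta. *)

(** * Exponential holding times *)

Lemma mem_set_bool (T : Type) (p : T -> bool) y : (y \in [set z | p z]) = p y.
Proof. by apply/idP/idP; rewrite inE. Qed.

Section exponential_weight.
Context {R : realType}.
Variable lambda : R.
Hypothesis lambda0 : 0 < lambda.

Local Notation leb := (@lebesgue_measure R).
Local Notation w := (exponential_pdf lambda : R -> R).

Lemma measurable_EFin_pdf : measurable_fun setT (fun t : R => (w t)%:E).
Proof. by apply/measurable_EFinP; exact: measurable_exponential_pdf. Qed.

Lemma integral_pdf_lt (h : R) : 0 <= h ->
  (\int[leb]_t (w t * (t < h)%R%:R)%:E = (1 - expR (- lambda * h))%:E)%E.
Proof.
move=> h0.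
transitivity (\int[leb]_(t in `[0%R, h[) (w t)%:E)%E.
  rewrite [RHS]integral_mkcond; apply: eq_integral => t _.
  rewrite patchE mem_setE /= in_itv/=.
  have [t0|t0] := leP 0 t; last by rewrite lt0_exponential_pdf ?mul0r.
  by case: (t < h); rewrite /= ?mulr1 ?mulr0.
move: h0; rewrite le_eqVlt => /predU1P[<-|h0].
  by rewrite set_itvco0 integral_set0 mulr0 expR0 subrr.
rewrite integral_itv_bndo_bndc; last first.
  by apply/measurable_funTS; exact: measurable_EFin_pdf.
by rewrite EFinB -(exponential_prob_itv0c _ h0).
Qed.

Lemma integral_pdf_between (a b : R) : 0 <= a -> a <= b ->
  (\int[leb]_t (w t * (a <= t < b)%R%:R)%:E =
   (expR (- lambda * a) - expR (- lambda * b))%:E)%E.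
Proof.
move=> a0 ab.
have mltR (c : R) : measurable_fun setT (fun t : R => t < c).
  exact: measurable_fun_ltr.
have mind (p : R -> bool) : measurable_fun setT p ->
    measurable_fun setT (fun t : R => (w t * (p t)%:R)%:E).
  move=> mp; apply/measurable_EFinP/measurable_funM => //.
    exact: measurable_exponential_pdf.
  exact: (@measurableT_comp _ _ _ _ _ _ (fun b : bool => b%:R : R)).
have ge (p : R -> bool) t : (0 <= (w t * (p t)%:R)%:E)%E.
  by rewrite lee_fin mulr_ge0// exponential_pdf_ge0// ltW.
have := integral_pdf_lt (le_trans a0 ab).
have -> : (\int[leb]_t (w t * (t < b)%R%:R)%:E =
  \int[leb]_t (w t * (t < a)%R%:R)%:E + \int[leb]_t (w t * (a <= t < b)%R%:R)%:E)%E.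
  have mab : measurable_fun setT (fun t : R => a <= t < b).
    by apply: measurable_and => //; exact: measurable_fun_ler.
  rewrite -(ge0_integralD leb measurableT (fun t _ => ge _ t) (mind _ (mltR a))
    (fun t _ => ge _ t) (mind _ mab)).
  apply: eq_integral => t _; rewrite -EFinD -mulrDr.
  have [ta|ta] := ltP t a; first by rewrite (lt_le_trans ta ab) addr0.
  by rewrite add0r.
rewrite integral_pdf_lt// => h.
have := congr1 (fun z => z - (1 - expR (- lambda * a))%:E)%E h.
by rewrite addeAC subee// add0e => ->; rewrite -EFinB; congr EFin; ring.
Qed.

(** The law of a jump process gives the tails of its holding times, on an event D
    and against a weight g that depends on other holding times. Since
    expR (- lambda * h) is 1 minus the mass that the exponential density of rate
    lambda gives to the interval from 0 to h, the tails determine the Laplace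
    transform, by Tonelli's theorem. *)
Lemma laplace_of_tails (d : measure_display) (Omega : measurableType d)
    (P : probability Omega R) (D : set Omega) (g H : Omega -> R) (c q : R) :
  measurable D -> measurable_fun setT g -> (forall o, 0 <= g o) ->
  measurable_fun setT H -> (forall o, 0 < H o) -> 0 <= c -> 0 < q ->
  (forall t, 0 <= t -> (\int[P]_(o in D `&` [set o | (t < H o)%R]) (g o)%:E =
                       (c * expR (- q * t))%:E)%E) ->
  (\int[P]_(o in D) (g o * expR (- lambda * H o))%:E =
   (c * (q / (q + lambda)))%:E)%E.
Proof.
move=> mD mg g0 mH H0 c0 q0 tails.
have tail0 : (\int[P]_(o in D) (g o)%:E = c%:E)%E.
  rewrite -[c]mulr1 -expR0 -[X in expR X](mulr0 (- q)) -tails//.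
  congr (integral _ _ _); apply/seteqP; split=> [y Dy|y []//].
  by split=> //; exact: H0.
pose k (z : Omega * R) : \bar R :=
  (g z.1 * \1_D z.1 * w z.2 * (z.2 < H z.1)%R%:R)%:E.
have k0 z : (0 <= k z)%E.
  by rewrite lee_fin !mulr_ge0// ?exponential_pdf_ge0// ltW.
have mk : measurable_fun setT k.
  apply/measurable_EFinP; apply: measurable_funM; first apply: measurable_funM.
  - apply: measurable_funM; first exact: measurableT_comp.
    by apply: measurableT_comp => //; exact: measurable_indic.
  - apply: measurableT_comp => //; exact: measurable_exponential_pdf.
  - apply: (@measurableT_comp _ _ _ _ _ _ (fun b : bool => b%:R : R)) => //.
    by apply: measurable_fun_ltr => //; exact: measurableT_comp.
have Dge0 o : D o -> (0 <= (g o * expR (- lambda * H o))%:E)%E.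
  by move=> _; rewrite lee_fin mulr_ge0 ?expR_ge0.
have mgE : measurable_fun setT (fun o => (g o * expR (- lambda * H o))%:E).
  apply/measurable_EFinP/measurable_funM => //.
  by apply: measurableT_comp => //; exact: measurable_funM.
have swap := @fubini_tonelli _ _ _ _ R P leb k mk k0.
have inner o : (\int[leb]_t k (o, t) =
    ((fun o => (g o - g o * expR (- lambda * H o))%:E) \_ D) o)%E.
  rewrite /k /= patchE; under eq_integral do rewrite -mulrA EFinM.
  rewrite ge0_integralZl//=; last 3 first.
  - apply/measurable_EFinP/measurable_funM; first exact: measurable_exponential_pdf.
    apply: (@measurableT_comp _ _ _ _ _ _ (fun b : bool => b%:R : R)) => //.
    exact: measurable_fun_ltr.
  - by move=> t _; rewrite lee_fin mulr_ge0// exponential_pdf_ge0// ltW.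
  - by rewrite lee_fin mulr_ge0.
  rewrite (_ : (\int[leb]_t _)%E = (1 - expR (- lambda * H o))%:E); last first.
    by rewrite -integral_pdf_lt// ltW.
  rewrite indicE; case: ifP => _; rewrite ?mulr0 ?mul0e// mulr1 -EFinM.
  by congr EFin; ring.
have outer t : (\int[P]_o k (o, t) =
    (c * lambda / (q + lambda) * exponential_pdf (q + lambda) t)%:E)%E.
  have [t0|t0] := leP 0 t; last first.
    rewrite (lt0_exponential_pdf _ t0) mulr0; apply: integral0_eq => o _.
    by rewrite /k /= lt0_exponential_pdf// mulr0 mul0r.
  rewrite !exponential_pdfE//.
  transitivity (\int[P]_o ((w t)%:E *
      ((fun o => (g o)%:E) \_ (D `&` [set o | (t < H o)%R])) o))%E.
    apply: eq_integral => o _.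
    rewrite /k /= patchE indicE in_setI mem_set_bool.
    rewrite (_ : point = 0%E)//.
    case: (o \in D); case: (t < H o);
      rewrite /= ?mulr1 ?mulr0 ?mul0r ?mule0//.
    by rewrite -EFinM mulrC.
  have mDt : measurable (D `&` [set o | t < H o]).
    apply: measurableI => //; rewrite (_ : [set _ | _] = H @^-1` `]t, +oo[).
      by rewrite -[X in measurable X]setTI; exact: mH.
    by apply/seteqP; split=> o /=; rewrite in_itv/= andbT.
  rewrite ge0_integralZl//=.
  - rewrite -integral_mkcond tails// exponential_pdfE//= -EFinM; congr EFin.
    rewrite (_ : - (q + lambda) * t = - q * t + - lambda * t); last by ring.
    by rewrite expRD; field; rewrite gt_eqF// addr_gt0.
  - apply/(measurable_restrictT _ _).1 => //; apply: measurable_funTS.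
    exact/measurable_EFinP.
  - by move=> o _; rewrite patchE; case: ifP => _ //; rewrite lee_fin.
  - by rewrite lee_fin exponential_pdf_ge0// ltW.
move: swap; under eq_integral do rewrite inner.
under [X in _ = X -> _]eq_integral do rewrite outer.
rewrite -integral_mkcond; under [X in _ = X -> _]eq_integral do rewrite EFinM.
have ql : 0 < q + lambda by rewrite addr_gt0.
rewrite [X in _ = X -> _]ge0_integralZl//=; last 3 first.
- apply/measurable_EFinP; exact: measurable_exponential_pdf.
- by move=> t _; rewrite lee_fin exponential_pdf_ge0// ltW.
- by rewrite lee_fin !mulr_ge0// ?invr_ge0 ltW.
rewrite integral_exponential_pdf// mule1 => loss.
have split_c : (\int[P]_(o in D) (g o * expR (- lambda * H o))%:E +
    \int[P]_(o in D) (g o - g o * expR (- lambda * H o))%:E = c%:E)%E.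
  rewrite -ge0_integralD//; last 3 first.
  - exact: measurable_funTS.
  - move=> o _; rewrite lee_fin subr_ge0 ler_piMr// expR_le1 mulNr oppr_le0.
    by rewrite mulr_ge0// ltW.
  - apply: measurable_funTS; apply/measurable_EFinP/measurable_funB => //.
    exact/measurable_EFinP.
  by rewrite -tail0; apply: eq_integral => o _; rewrite -EFinD; congr EFin; ring.
move: split_c; rewrite loss => h.
have := congr1 (fun z => z - (c * lambda / (q + lambda))%:E)%E h.
rewrite -addeA subee// adde0 => ->; rewrite -EFinB; congr EFin.
by field; rewrite gt_eqF.
Qed.

End exponential_weight.

(** * Discounted rewards along the paths of a jump process *)

Definition generator (R : realType) (T : Type) (J : finType)
    (target : J -> T -> T) (rate : J -> T -> R) (f : T -> R) (x : T) : R :=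
  \sum_(j : J) rate j x * (f (target j x) - f x).

Section jump_paths.
Context {R : realType} {d d' : measure_display} {T : measurableType d'}.
Context {J : finType} (target : J -> T -> T) (rate : J -> T -> R).
Hypothesis measurable_discrete : forall A : set T, measurable A.
Hypothesis rate_ge0 : forall j x, 0 <= rate j x.
Hypothesis total_rate_gt0 : forall x, 0 < total_rate rate x.

Local Notation q := (total_rate rate).
Local Notation p := (jump_prob target rate).

Definition successors x : seq T := undup [seq target j x | j : J].

Lemma sum_successors x (f : T -> R) :
  \sum_(z <- successors x) p x z * f z =
  (\sum_(j : J) rate j x * f (target j x)) / q x.
Proof.
transitivity (\sum_(z <- successors x) \sum_(j : J)
    (if target j x == z then rate j x * f z else 0) / q x).
  apply: eq_bigr => z _; rewrite /jump_prob -mulr_suml -big_mkcond/=.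
  by rewrite mulrAC mulr_suml.
rewrite exchange_big mulr_suml/=; apply: eq_bigr => j _.
have xj : target j x \in successors x by rewrite mem_undup map_f// mem_enum.
rewrite (bigD1_seq _ xj (undup_uniq _))/= eqxx big1 ?addr0// => z zj.
by rewrite eq_sym (negbTE zj) mul0r.
Qed.

Lemma sum_jump_prob x : \sum_(z <- successors x) p x z = 1.
Proof.
transitivity (\sum_(z <- successors x) p x z * (fun=> 1) z).
  by apply: eq_bigr => z _; rewrite mulr1.
rewrite sum_successors; under eq_bigr do rewrite mulr1.
by rewrite -/(total_rate rate x) divff// gt_eqF.
Qed.

Lemma jump_prob_ge0 x z : 0 <= p x z.
Proof.
by rewrite divr_ge0 ?(ltW (total_rate_gt0 x))//; apply: sumr_ge0 => j _.
Qed.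

Section process.
Context {Omega : measurableType d} (P : probability Omega R) (u : T).
Variables (Y : nat -> {RV P >-> T}) (H : nat -> {RV P >-> R}).
Hypothesis holding_gt0 : forall n o, 0 < H n o.
Hypothesis law : forall (n : nat) (x : nat -> T) (t : nat -> R),
  (forall i, 0 <= t i) ->
  P [set o | (forall i, (i <= n)%N -> Y i o = x i) /\
             (forall i, (i < n)%N -> t i < H i o)] =
  ((x 0%N == u)%:R *
   \prod_(i < n) (expR (- q (x i) * t i) * p (x i) (x i.+1)))%:E.
Variable lambda : R.
Hypothesis lambda0 : 0 < lambda.

Lemma measurable_state n (A : set T) : measurable [set o | A (Y n o)].
Proof.
rewrite -[X in measurable X]setTI.
by apply: (measurable_funP (Y n)) => //; exact: measurable_discrete.
Qed.

Lemma measurable_holding_gt n t : measurable [set o | t < H n o].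
Proof.
rewrite (_ : [set _ | _] = H n @^-1` `]t, +oo[).
  by rewrite -[X in measurable X]setTI; exact: (measurable_funP (H n)).
by apply/seteqP; split=> y /=; rewrite in_itv/= andbT.
Qed.

Definition path_tails n (x : nat -> T) k (t : nat -> R) : set Omega :=
  [set o | (forall i, (i <= n)%N -> Y i o = x i) /\
           (forall i, (k <= i < n)%N -> t i < H i o)].

Definition path_event n (x : nat -> T) : set Omega :=
  [set o | forall i, (i <= n)%N -> Y i o = x i].

(** The discount factor expR (- lambda * t) at the [n]-th jump time t, in the form
    to which the law of the holding times applies. *)
Definition discount n (o : Omega) : R :=
  \prod_(i < n) expR (- lambda * H i o).

Definition path_weight n (x : nat -> T) : R :=
  (x 0%N == u)%:R *
  \prod_(i < n) (q (x i) / (q (x i) + lambda) * p (x i) (x i.+1)).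

Lemma measurable_path n x : measurable (path_event n x).
Proof.
rewrite (_ : path_event n x =
    \bigcap_(i in [set i | (i <= n)%N]) [set o | Y i o = x i]).
  by apply: bigcap_measurableType => i _; exact: (measurable_state i [set x i]).
by apply/seteqP; split=> y /= h i; exact: h.
Qed.

Lemma measurable_path_tails n x k t : measurable (path_tails n x k t).
Proof.
rewrite (_ : path_tails n x k t = path_event n x `&`
    \bigcap_(i in [set i | (k <= i < n)%N]) [set o | t i < H i o]).
  apply: measurableI; first exact: measurable_path.
  by apply: bigcap_measurableType => i _; exact: measurable_holding_gt.
by apply/seteqP; split=> y /= -[h1 h2]; split=> // i; exact: h2.
Qed.

Lemma discountS n o : discount n.+1 o = discount n o * expR (- lambda * H n o).
Proof. by rewrite /discount big_ord_recr. Qed.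

Lemma discount_ge0 n o : 0 <= discount n o.
Proof. by apply: prodr_ge0 => i _; exact: expR_ge0. Qed.

Lemma discount_le n o : discount n.+1 o <= discount n o.
Proof.
rewrite discountS ler_piMr ?discount_ge0// expR_le1 mulNr oppr_le0.
by rewrite mulr_ge0// ltW.
Qed.

Lemma measurable_discount n : measurable_fun setT (discount n).
Proof.
elim: n => [|n IH].
  rewrite (_ : discount 0 = cst 1)//.
  by apply/funext => y; rewrite /discount big_ord0.
rewrite (_ : discount n.+1 = fun o => discount n o * expR (- lambda * H n o)).
  apply: measurable_funM => //; apply: measurableT_comp => //.
  exact: measurable_funM.
by apply/funext => y; exact: discountS.
Qed.

(** By induction on [k]: at each step [laplace_of_tails] trades the tail of one
    more holding time for the Laplace transform of its law. *)
Lemma laplace_path_tails n x k t : (k <= n)%N -> (forall i, 0 <= t i) ->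
  (\int[P]_(o in path_tails n x k t) (discount k o)%:E =
   ((x 0%N == u)%:R * \prod_(i < n) ((if (i < k)%N then q (x i) / (q (x i) + lambda)
      else expR (- q (x i) * t i)) * p (x i) (x i.+1)))%:E)%E.
Proof.
elim: k t => [|k IH] t kn t0.
  under eq_integral do rewrite /discount big_ord0.
  rewrite integral_cst ?mul1e; last exact: measurable_path_tails.
  exact: law.
pose c := (x 0%N == u)%:R * (p (x k) (x k.+1) *
  \prod_(i < n | (i : nat) != k) ((if (i < k)%N then q (x i) / (q (x i) + lambda)
      else expR (- q (x i) * t i)) * p (x i) (x i.+1))).
have neq_k (i : 'I_n) : (i != Ordinal kn) = ((i : nat) != k) by [].
have -> : ((x 0%N == u)%:R * \prod_(i < n) ((if (i < k.+1)%N
    then q (x i) / (q (x i) + lambda)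
    else expR (- q (x i) * t i)) * p (x i) (x i.+1))) =
    c * (q (x k) / (q (x k) + lambda)).
  rewrite (bigD1 (Ordinal kn))//= ltnS leqnn /c.
  under eq_bigl do rewrite neq_k.
  rewrite (eq_bigr (fun i : 'I_n => (if (i < k)%N then q (x i) / (q (x i) + lambda)
      else expR (- q (x i) * t i)) * p (x i) (x i.+1))); first by ring.
  by move=> i ik; rewrite ltnS leq_eqVlt (negbTE ik).
under eq_integral do rewrite discountS.
apply: (laplace_of_tails lambda0) => //.
- exact: measurable_path_tails.
- exact: measurable_discount.
- by move=> y; exact: discount_ge0.
- apply: mulr_ge0; first exact: ler0n.
  apply: mulr_ge0; first exact: jump_prob_ge0.
  apply: prodr_ge0 => i _; apply: mulr_ge0; last exact: jump_prob_ge0.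
  case: ifP => _; last exact: expR_ge0.
  by rewrite divr_ge0 ?addr_ge0// ltW.
move=> s s0.
pose t' i := if i == k then s else t i.
have -> : path_tails n x k.+1 t `&` [set o | s < H k o] = path_tails n x k t'.
  apply/seteqP; split=> y.
    move=> [[h1 h2] h3]; split=> // i /andP[ki ni]; rewrite /t'.
    by case: eqP => [->//|/eqP ik]; apply: h2; rewrite ni andbT ltn_neqAle eq_sym ik.
  move=> [h1 h2]; split; first split=> //.
    move=> i /andP[ki ni]; have := h2 i; rewrite /t' (ltnW ki) ni (gtn_eqF ki).
    exact.
  by have := h2 k; rewrite /t' leqnn kn eqxx; exact.
rewrite IH; [|exact: ltnW|by move=> i; rewrite /t'; case: ifP].
congr EFin; rewrite (bigD1 (Ordinal kn))//= ltnn /t' eqxx /c.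
under eq_bigl do rewrite neq_k.
rewrite (eq_bigr (fun i : 'I_n => (if (i < k)%N then q (x i) / (q (x i) + lambda)
    else expR (- q (x i) * t i)) * p (x i) (x i.+1))); first by ring.
by move=> i ik; rewrite (negbTE ik).
Qed.

Lemma integral_discount_path n x :
  (\int[P]_(o in path_event n x) (discount n o)%:E = (path_weight n x)%:E)%E.
Proof.
have -> : path_event n x = path_tails n x n (fun=> 0).
  apply/seteqP; split=> y; last by case.
  by move=> h; split=> // i; case: ltnP => //; rewrite ?andbF// => ni /andP[].
rewrite laplace_path_tails//; congr EFin; rewrite /path_weight; congr (_ * _).
by apply: eq_bigr => i _; rewrite ltn_ord.
Qed.

Lemma prob_path n x :
  P (path_event n x) = ((x 0%N == u)%:R * \prod_(i < n) p (x i) (x i.+1))%:E.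
Proof.
have := @law n x (fun=> 0) (fun=> lexx 0).
under eq_bigr do rewrite mulr0 expR0 mul1r; move=> <-.
congr (P _); apply/seteqP; split=> y /=; last by case.
by move=> h; split.
Qed.

Definition extend n (x : nat -> T) z i : T := if i == n.+1 then z else x i.

Lemma extend_leq n x z i : (i <= n)%N -> extend n x z i = x i.
Proof. by move=> ni; rewrite /extend ltn_eqF. Qed.

Lemma extend_last n x z : extend n x z n.+1 = z.
Proof. by rewrite /extend eqxx. Qed.

Lemma path_extendE n x z :
  path_event n.+1 (extend n x z) = path_event n x `&` [set o | Y n.+1 o = z].
Proof.
apply/seteqP; split=> y /=.
  move=> h; split; last by have := h _ (leqnn _); rewrite extend_last.
  by move=> i ni; rewrite h ?(leq_trans ni)// extend_leq.
move=> [h hz] i; rewrite leq_eqVlt ltnS => /predU1P[->|ni].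
  by rewrite extend_last.
by rewrite extend_leq// h.
Qed.

Lemma path_weight_extend n x z : path_weight n.+1 (extend n x z) =
  path_weight n x * (q (x n) / (q (x n) + lambda) * p (x n) z).
Proof.
rewrite /path_weight big_ord_recr/= extend_last (@extend_leq n x z 0)//.
rewrite (@extend_leq n x z n)// mulrA.
congr (_ * _ * _); apply: eq_bigr => i _.
by rewrite (@extend_leq n x z i) ?(@extend_leq n x z i.+1)// ltnW.
Qed.

Lemma path_weight_ge0 n x : 0 <= path_weight n x.
Proof.
apply: mulr_ge0; first exact: ler0n.
apply: prodr_ge0 => i _; apply: mulr_ge0; last exact: jump_prob_ge0.
by rewrite divr_ge0 ?addr_ge0// ltW.
Qed.

(** The jump probabilities from [x n] to its successors add up to 1, so the paths
    that jump elsewhere have probability 0; this makes the sum over the next state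
    a finite one. *)
Lemma integral_path_split n x (g : Omega -> R) :
  measurable_fun setT g -> (forall o, 0 <= g o) ->
  (\int[P]_(o in path_event n x) (g o)%:E =
   \sum_(z <- successors (x n))
     \int[P]_(o in path_event n.+1 (extend n x z)) (g o)%:E)%E.
Proof.
move=> mg g0.
pose F z := path_event n.+1 (extend n x z).
have mF z : measurable (F z) by exact: measurable_path.
pose B := \big[setU/set0]_(z <- successors (x n)) F z.
have mB : measurable B by apply: bigsetU_measurable => z _.
have tF : trivIset [set` successors (x n)] F.
  apply/trivIsetP => z z' _ _ zz'; apply/seteqP; split=> y //=.
  rewrite /F !path_extendE => -[[_ /= ->] [_ /= zE]].
  by move/eqP: zz'; apply.
have sumB (h : Omega -> R) : measurable_fun setT h -> (forall o, 0 <= h o) ->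
    (\int[P]_(o in B) (h o)%:E =
     \sum_(z <- successors (x n)) \int[P]_(o in F z) (h o)%:E)%E.
  move=> mh h0; apply: ge0_integral_bigsetU => //.
  - exact: undup_uniq.
  - by apply: measurable_funTS; exact/measurable_EFinP.
  - by move=> y _; rewrite lee_fin.
have Bpath : B `<=` path_event n x.
  rewrite /B => y; rewrite -bigcup_seq => -[z _].
  by rewrite /F path_extendE => -[].
have mC : measurable (path_event n x `\` B).
  by apply: measurableD => //; exact: measurable_path.
have split_path : path_event n x = B `|` (path_event n x `\` B) by rewrite setDUK.
have disj : [disjoint B & path_event n x `\` B] by apply/disj_setPS => y [By [_]].
have PB : P B = P (path_event n x).
  have := sumB (cst 1) (measurable_cst _) (fun=> ler01).
  rewrite (integral_cst P mB 1%E) mul1e => ->.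
  transitivity (\sum_(z <- successors (x n)) P (F z))%E.
    by apply: eq_bigr => z _; rewrite (integral_cst P (mF z) 1%E) mul1e.
  transitivity (\sum_(z <- successors (x n))
    ((x 0%N == u)%:R * (\prod_(i < n) p (x i) (x i.+1)) * p (x n) z)%:E)%E.
    apply: eq_bigr => z _; rewrite /F prob_path; congr EFin.
    rewrite big_ord_recr/= extend_last (@extend_leq n x z 0)//.
    rewrite (@extend_leq n x z n)// mulrA.
    by congr (_ * _ * _); apply: eq_bigr => i _;
      rewrite (@extend_leq n x z i) ?(@extend_leq n x z i.+1)// ltnW.
  by rewrite sumEFin -mulr_sumr sum_jump_prob mulr1 prob_path.
have PC : P (path_event n x `\` B) = 0%E.
  have mpath : measurable (path_event n x) by exact: measurable_path.
  have -> : P (path_event n x `\` B) =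
      (P (path_event n x) - P (path_event n x `&` B))%E.
    by apply: measureD => //; rewrite ltey_eq fin_num_measure.
  by rewrite setIidr// PB subee// fin_num_measure.
rewrite {1}split_path ge0_integral_setU//.
- rewrite sumB// [X in (_ + X)%E]null_set_integral ?adde0//.
  by apply: measurable_funTS; exact/measurable_EFinP.
- by apply: measurable_funTS; exact/measurable_EFinP.
- by move=> y _; rewrite lee_fin.
Qed.

Section discounted_reward.
Variables (D : set T) (r f : T -> R).
Hypothesis r_ge0 : forall x, 0 <= r x.
Hypothesis f_ge0 : forall x, 0 <= f x.

(** [lambda] times the integral over time of the discounted reward [r], from the
    [n]-th jump on, over [M] holding times or until the path leaves [D]. *)
Fixpoint reward M n (o : Omega) : R :=
  if M is M'.+1 then
    \1_D (Y n o) * (r (Y n o) * (discount n o - discount n.+1 o) +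
                    reward M' n.+1 o)
  else 0.

Lemma reward_ge0 M n o : 0 <= reward M n o.
Proof.
elim: M n => [//|M IH] n /=.
by rewrite mulr_ge0// addr_ge0// mulr_ge0// subr_ge0 discount_le.
Qed.

Lemma measurable_of_state (h : T -> R) n : measurable_fun setT (fun o => h (Y n o)).
Proof.
move=> _ A mA; rewrite setTI.
exact: (measurable_state n (h @^-1` A)).
Qed.

Lemma measurable_reward M n : measurable_fun setT (reward M n).
Proof.
elim: M n => [|M IH] n /=; first exact: measurable_cst.
apply: measurable_funM; first exact: measurable_of_state.
apply: measurable_funD => //; apply: measurable_funM.
  exact: measurable_of_state.
by apply: measurable_funB; exact: measurable_discount.
Qed.

Hypothesis supersolution : forall x, D x ->
  lambda * r x + generator target rate f x <= lambda * f x.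

(** The discounted value of [f], plus the reward accumulated so far, is a
    supermartingale as long as the path stays in [D]. The proof conditions on the
    first of the [M] jumps. *)
Lemma integral_reward_path M n x :
  (\int[P]_(o in path_event n x) (reward M n o)%:E <=
   (f (x n) * path_weight n x)%:E)%E.
Proof.
elim: M n x => [|M IH] n x /=.
  by rewrite integral0 lee_fin mulr_ge0// path_weight_ge0.
have rhs0 : 0 <= f (x n) * path_weight n x by rewrite mulr_ge0// path_weight_ge0.
have [Dx|nDx] := pselect (D (x n)); last first.
  rewrite (@eq_integral _ _ _ P (path_event n x) (cst 0%E)) ?integral0//.
  move=> y /set_mem/(_ n (leqnn n)) ->.
  by rewrite indicE memNset// mul0r.
rewrite (@eq_integral _ _ _ P (path_event n x)
  (fun o => (r (x n) * (discount n o - discount n.+1 o))%:E +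
            (reward M n.+1 o)%:E)%E); last first.
  move=> y /set_mem/(_ n (leqnn n)) ->.
  by rewrite indicE mem_set// mul1r EFinD.
have mdB : measurable_fun setT (fun o => discount n o - discount n.+1 o).
  by apply: measurable_funB; exact: measurable_discount.
have dB0 y : 0 <= discount n y - discount n.+1 y by rewrite subr_ge0 discount_le.
rewrite ge0_integralD//; last 5 first.
- exact: measurable_path.
- by move=> y _; rewrite lee_fin mulr_ge0.
- by apply: measurable_funTS; apply/measurable_EFinP/measurable_funM.
- by move=> y _; rewrite lee_fin reward_ge0.
- by apply: measurable_funTS; apply/measurable_EFinP; exact: measurable_reward.
under eq_integral do rewrite EFinM.
rewrite ge0_integralZl//; last 4 first.
- exact: measurable_path.
- by apply: measurable_funTS; exact/measurable_EFinP.
- by move=> y _; rewrite lee_fin.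
- by rewrite lee_fin.
have qx := total_rate_gt0 (x n).
have ql : 0 < q (x n) + lambda by rewrite addr_gt0.
set w := path_weight n x.
have next : (\int[P]_(o in path_event n x) (discount n.+1 o)%:E =
    (w * (q (x n) / (q (x n) + lambda)))%:E)%E.
  rewrite integral_path_split; [|exact: measurable_discount|exact: discount_ge0].
  under eq_bigr do rewrite integral_discount_path path_weight_extend mulrA.
  by rewrite sumEFin -mulr_sumr sum_jump_prob mulr1.
have loss : (\int[P]_(o in path_event n x) (discount n o - discount n.+1 o)%:E =
    (w * (lambda / (q (x n) + lambda)))%:E)%E.
  have : (\int[P]_(o in path_event n x) (discount n o - discount n.+1 o)%:E +
      \int[P]_(o in path_event n x) (discount n.+1 o)%:E = w%:E)%E.
    rewrite -ge0_integralD//; last 5 first.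
    - exact: measurable_path.
    - by move=> y _; rewrite lee_fin.
    - by apply: measurable_funTS; exact/measurable_EFinP.
    - by move=> y _; rewrite lee_fin discount_ge0.
    - by apply: measurable_funTS; apply/measurable_EFinP; exact: measurable_discount.
    rewrite -integral_discount_path; apply: eq_integral => y _.
    by rewrite -EFinD subrK.
  rewrite next => h.
  have := congr1 (fun z => z - (w * (q (x n) / (q (x n) + lambda)))%:E)%E h.
  rewrite -addeA subee// adde0 => ->; rewrite -EFinB; congr EFin.
  by field; rewrite gt_eqF.
rewrite loss integral_path_split;
  [|exact: measurable_reward|exact: reward_ge0].
have step : (\sum_(z <- successors (x n))
    \int[P]_(o in path_event n.+1 (extend n x z)) (reward M n.+1 o)%:E <=
    \sum_(z <- successors (x n))
      (f z * (w * (q (x n) / (q (x n) + lambda) * p (x n) z)))%:E)%E.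
  apply: lee_sum => z _; apply: le_trans (IH _ _) _.
  by rewrite extend_last path_weight_extend.
apply: le_trans (leeD (le_refl _) step) _.
rewrite sumEFin -EFinM -EFinD lee_fin.
have -> : \sum_(z <- successors (x n))
    f z * (w * (q (x n) / (q (x n) + lambda) * p (x n) z)) =
    w / (q (x n) + lambda) * \sum_(j : J) rate j (x n) * f (target j (x n)).
  rewrite (eq_bigr (fun z => w / (q (x n) + lambda) * q (x n) * (p (x n) z * f z))).
    rewrite -mulr_sumr sum_successors; field.
    by rewrite !gt_eqF.
  by move=> z _; ring.
have genE : generator target rate f (x n) =
    \sum_(j : J) rate j (x n) * f (target j (x n)) - q (x n) * f (x n).
  rewrite /generator /total_rate mulr_suml -sumrB.
  by apply: eq_bigr => j _; rewrite mulrBr.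
have := supersolution Dx; rewrite genE => sup.
have c0 : 0 <= w / (q (x n) + lambda) by rewrite divr_ge0 ?path_weight_ge0// ltW.
set S := \sum_(j : J) _ in sup *.
have le1 : lambda * r (x n) + S <= (q (x n) + lambda) * f (x n) by lra.
have := ler_wpM2l c0 le1.
have -> : w / (q (x n) + lambda) * ((q (x n) + lambda) * f (x n)) = f (x n) * w.
  by field; rewrite gt_eqF.
apply: le_trans; rewrite le_eqVlt; apply/orP; left; apply/eqP; ring.
Qed.

Lemma integral_reward M :
  (\int[P]_o (reward M 0 o)%:E <= (f u)%:E)%E.
Proof.
have := integral_reward_path M 0 (fun=> u).
rewrite /path_weight big_ord0 eqxx !mulr1; apply: le_trans.
have m0 : measurable (path_event 0 (fun=> u)) by exact: measurable_path.
have P0 : P (path_event 0 (fun=> u)) = 1%E by rewrite prob_path big_ord0 eqxx mulr1.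
have mE : measurable_fun setT (fun o => (reward M 0 o)%:E).
  by apply/measurable_EFinP; exact: measurable_reward.
have PC0 : P (~` path_event 0 (fun=> u)) = 0%E by rewrite probability_setC// P0 subee.
rewrite (@ge0_negligible_integral _ _ _ P setT (~` path_event 0 (fun=> u)))//.
- by rewrite setTD setCK.
- exact: measurableC.
- by move=> y _; rewrite lee_fin reward_ge0.
Qed.

End discounted_reward.

Section trajectories.
Variable U : R -> Omega -> T.
Hypothesis non_explosive :
  forall o, series (fun i => H i o) n @[n --> \oo] --> +oo.
Hypothesis trajectory : forall o n t,
  series (fun i => H i o) n <= t < series (fun i => H i o) n.+1 -> U t o = Y n o.

Local Notation density := (exponential_pdf lambda : R -> R).
Local Notation leb := (@lebesgue_measure R).

Definition jump_time n o : R := series (fun i => H i o) n.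

Lemma jump_time0 o : jump_time 0 o = 0.
Proof. by rewrite /jump_time seriesEord /= big_ord0. Qed.

Lemma jump_timeS n o : jump_time n.+1 o = jump_time n o + H n o.
Proof. by rewrite /jump_time !seriesEord /= big_ord_recr. Qed.

Lemma jump_time_le m n o : (m <= n)%N -> jump_time m o <= jump_time n o.
Proof.
move=> /subnK <-; elim: (n - m)%N => [//|k IH].
by rewrite addSn jump_timeS; have := holding_gt0 (k + m) o; move: IH; lra.
Qed.

Lemma jump_time_ge0 n o : 0 <= jump_time n o.
Proof. by rewrite -(jump_time0 o); exact: jump_time_le. Qed.

Lemma ex_jump_time_gt o t : exists n, t < jump_time n o.
Proof.
have /cvgryPgt/(_ t)[n _ h] := @non_explosive o.
by exists n; apply: h => /=.
Qed.

Lemma ex_jump_interval o t : 0 <= t ->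
  exists n, jump_time n o <= t < jump_time n.+1 o.
Proof.
move=> t0; have ex := ex_jump_time_gt o t.
case: (ex_minnP ex) => -[|n] tn minn; first by move: tn; rewrite jump_time0; lra.
exists n; rewrite tn andbT leNgt; apply/negP => /minn.
by rewrite ltnn.
Qed.

Lemma measurable_jump_time n : measurable_fun setT (jump_time n).
Proof.
rewrite (_ : jump_time n = fun o => \sum_(i <- iota 0 n) H i o).
  by apply: measurable_sum => i; exact: (measurable_funP (H i)).
by apply/funext => y; rewrite /jump_time seriesEnat /= /index_iota subn0.
Qed.

Lemma discountE n o : discount n o = expR (- lambda * jump_time n o).
Proof.
elim: n => [|n IH]; first by rewrite /discount big_ord0 jump_time0 mulr0 expR0.
by rewrite discountS IH jump_timeS mulrDr expRD.
Qed.

Definition stay n (B : set T) t : set Omega :=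
  [set o | B (Y n o)] `&` [set o | jump_time n o <= t < jump_time n.+1 o].

Lemma trajectory_stay (B : set T) t : 0 <= t ->
  [set o | B (U t o)] = \bigcup_n stay n B t.
Proof.
move=> t0; apply/seteqP; split=> y /=.
  have [n nt] := ex_jump_interval y t0.
  by rewrite (trajectory nt) => By; exists n.
by move=> [n _ [/= By nt]]; rewrite (trajectory nt).
Qed.

Lemma measurable_jump_interval (t : R) n :
  measurable_fun setT (fun o => jump_time n o <= t < jump_time n.+1 o).
Proof.
apply: measurable_and; [apply: measurable_fun_ler|apply: measurable_fun_ltr] => //;
  exact: measurable_jump_time.
Qed.

Lemma measurable_stay n B t : measurable (stay n B t).
Proof.
apply: measurableI; first exact: (measurable_state n B).
have mtrue : measurable ([set true] : set bool) by [].
by have := measurable_jump_interval t n measurableT mtrue; rewrite setTI.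
Qed.

Lemma trivIset_stay B t : trivIset setT (fun n => stay n B t).
Proof.
apply/trivIsetP => m n _ _ mn; apply/seteqP; split=> y //= -[[_ /= hm] [_ /= hn]].
wlog lmn : m n mn hm hn / (m < n)%N.
  move=> W; case: (ltngtP m n) => [|h|h]; first exact: (W m n).
    by apply: (W n m) => //; rewrite eq_sym.
  by move/eqP: mn.
have := jump_time_le y lmn; move: hm hn => /andP[_ h1] /andP[h2 _]; lra.
Qed.

Lemma prob_trajectory (B : set T) t : 0 <= t ->
  (P [set o | B (U t o)] = \sum_(n <oo) P (stay n B t))%E.
Proof.
move=> t0; rewrite trajectory_stay//; apply: measure_semi_bigcup.
- by move=> n; exact: measurable_stay.
- exact: trivIset_stay.
- by apply: bigcupT_measurable => n; exact: measurable_stay.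
Qed.

(** Unlike the trajectories [U] themselves, each of these terms is seen at once to
    be jointly measurable in the outcome and the time. *)
Let occupation (B : set T) n (z : Omega * R) : \bar R :=
  (\1_B (Y n z.1) *
   (density z.2 * (jump_time n z.1 <= z.2 < jump_time n.+1 z.1)%R%:R))%:E.

Let occupation_ge0 B n z : (0 <= occupation B n z)%E.
Proof.
by rewrite lee_fin mulr_ge0// mulr_ge0// exponential_pdf_ge0// ltW.
Qed.

Let measurable_occupation B n : measurable_fun setT (occupation B n).
Proof.
apply/measurable_EFinP/measurable_funM.
  exact: (measurableT_comp (@measurable_of_state (\1_B) n) measurable_fst).
apply: measurable_funM.
  by apply: measurableT_comp => //; exact: measurable_exponential_pdf.
apply: (@measurableT_comp _ _ _ _ _ _ (fun b : bool => b%:R : R)) => //.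
by apply: measurable_and; [apply: measurable_fun_ler|apply: measurable_fun_ltr] => //;
  exact: (measurableT_comp (@measurable_jump_time _) measurable_fst).
Qed.

Lemma discounted_occupation (B : set T) t :
  ((density t)%:E * P [set o | B (U t o)] =
   \sum_(n <oo) \int[P]_o occupation B n (o, t))%E.
Proof.
have [t0|t0] := leP 0 t; last first.
  rewrite lt0_exponential_pdf// mul0e eseries0// => n _ _.
  by apply: integral0_eq => y _; rewrite /occupation lt0_exponential_pdf// mul0r mulr0.
rewrite prob_trajectory// -nneseriesZl; last by move=> *; exact: measure_ge0.
apply: eq_eseriesr => n _.
rewrite -[stay _ _ _]setIT -integral_indic//; last exact: measurable_stay.
rewrite -ge0_integralZl//=; last 2 first.
- apply/measurable_EFinP/measurable_indic; exact: measurable_stay.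
- by rewrite lee_fin exponential_pdf_ge0// ltW.
apply: eq_integral => y _; rewrite /occupation/= -EFinM; congr EFin.
rewrite !indicE /stay in_setI mem_set_bool.
rewrite (_ : (y \in [set o | B (Y n o)]) = (Y n y \in B)).
  by case: (_ \in B); case: (_ <= _ < _); rewrite /= ?mulr0 ?mul0r ?mulr1 ?mul1r.
by apply/idP/idP; rewrite !inE.
Qed.

Lemma measurable_discounted_occupation (B : set T) :
  measurable_fun setT (fun t => ((density t)%:E * P [set o | B (U t o)])%E).
Proof.
under eq_fun do rewrite discounted_occupation.
apply: (ge0_emeasurable_sum (P := xpredT)) => n.
  by move=> t _ _; exact: integral_ge0.
move=> _; exact: (@measurable_fun_fubini_tonelli_G _ _ Omega (measurableTypeR R)
  R P _ (measurable_occupation B n) (@occupation_ge0 B n)).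
Qed.

(** The left-hand side is the probability of being in [B] at an independent
    exponential time of rate [lambda]. On the [n]-th jump interval the exponential
    density has mass [discount n - discount n.+1], so it is the limit of the
    expectations of [reward] with the indicator of [B] as the reward. *)
Lemma discounted_occupation_le (B : set T) (f : T -> R) :
  (forall x, 0 <= f x) ->
  (forall x, lambda * \1_B x + generator target rate f x <= lambda * f x) ->
  (\int[leb]_t ((density t)%:E * P [set o | B (U t o)]) <= (f u)%:E)%E.
Proof.
move=> f0 sup; under eq_integral do rewrite discounted_occupation.
rewrite integral_nneseries//; last 2 first.
- by move=> n; exact: (@measurable_fun_fubini_tonelli_G _ _ Omega
    (measurableTypeR R) R P _ (measurable_occupation B n) (@occupation_ge0 B n)).
- by move=> n t _; exact: integral_ge0.
have kn n : (\int[leb]_t \int[P]_o occupation B n (o, t) =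
    \int[P]_o (\1_B (Y n o) * (discount n o - discount n.+1 o))%:E)%E.
  rewrite -(@fubini_tonelli _ _ _ _ R P leb _ (measurable_occupation B n) (@occupation_ge0 B n)).
  apply: eq_integral => y _; rewrite /occupation /=; under eq_integral do rewrite EFinM.
  rewrite ge0_integralZl//=; last 2 first.
  - apply/measurable_EFinP/measurable_funM; first exact: measurable_exponential_pdf.
    apply: (@measurableT_comp _ _ _ _ _ _ (fun b : bool => b%:R : R)) => //.
    by apply: measurable_and; [apply: measurable_fun_ler|apply: measurable_fun_ltr].
  - by move=> t _; rewrite lee_fin mulr_ge0// exponential_pdf_ge0// ltW.
  by rewrite integral_pdf_between ?jump_time_ge0 ?jump_time_le// !discountE -EFinM.
under eq_eseriesr do rewrite kn.
apply: lime_le; first by apply: is_cvg_nneseries => n _ _; apply: integral_ge0 => y _;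
  rewrite lee_fin mulr_ge0// subr_ge0 discount_le.
near=> M; rewrite -ge0_integral_sum//; last 2 first.
- move=> n; apply/measurable_EFinP/measurable_funM; first exact: measurable_of_state.
  by apply: measurable_funB; exact: measurable_discount.
- by move=> n y _; rewrite lee_fin mulr_ge0// subr_ge0 discount_le.
have accE m y n : (\sum_(n <= i < n + m) (\1_B (Y i y) *
    (discount i y - discount i.+1 y)))%R =
    reward setT (\1_B) m n y.
  elim: m n => [|m IH] n /=; first by rewrite addn0 big_geq.
  rewrite big_ltn ?addnS ?ltnS ?leq_addr// -addSn IH.
  by rewrite [\1_setT _]indicE in_setT mul1r.
apply: le_trans (integral_reward (D := setT) (r := \1_B) _ f0 _ M) => //.
by under eq_integral do rewrite sumEFin -[X in index_iota 0 X]add0n accE.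
Unshelve. all: by end_near.
Qed.

(** A path is constant between its jumps, so it enters [B] at a jump time. The
    right-hand side is a countable intersection of events. *)
Lemma hitting_time_gtE (B : set T) (s : R) : 0 <= s ->
  [set o | (s%:E < hitting_time U B o)%E] =
  \bigcap_n ([set o | ~ B (Y n o)] `|` [set o | s < jump_time n o]).
Proof.
move=> s0; apply/seteqP; split=> y /=.
  move=> sy n _; apply: contrapT => /not_orP[/contrapT By /negP].
  rewrite -leNgt => tn; move: sy; apply/negP; rewrite -leNgt.
  (* The times at which [U] is evaluated are positive, and the jump time may be
     0; so evaluate [U] slightly later, within the same holding time. *)
  apply/lee_addgt0Pr => e e0; apply: (@le_trans _ _
    (jump_time n y + Num.min e (H n y / 2))%:E); last first.
    by rewrite -EFinD lee_fin lerD// ge_min lexx.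
  apply: ereal_inf_lbound; exists (jump_time n y + Num.min e (H n y / 2)) => //=.
  have Hn := holding_gt0 n y.
  have m0 : 0 < Num.min e (H n y / 2) by rewrite lt_min e0 divr_gt0.
  have mH : Num.min e (H n y / 2) <= H n y / 2 by rewrite ge_min lexx orbT.
  have tn0 := jump_time_ge0 n y.
  split; first by lra.
  rewrite (@trajectory y n)//; rewrite -!/(jump_time _ _) jump_timeS.
  by apply/andP; split; lra.
move=> h; have [[n Bn]|nB] := pselect (exists n, B (Y n y)); last first.
  rewrite /hitting_time (_ : [set _ | _] = set0) ?image_set0 ?ereal_inf0 ?ltry//.
  apply/seteqP; split=> t //= -[t0 Bt]; apply: nB.
  have [n nt] := ex_jump_interval y (ltW t0).
  by exists n; rewrite -(trajectory nt).
have ex : exists n, `[< B (Y n y) >] by exists n; apply/asboolP.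
case: (ex_minnP ex) => m /asboolP Bm minm.
have sm : s < jump_time m y by have [] := h m I.
apply: (@lt_le_trans _ _ (jump_time m y)%:E); first by rewrite lte_fin.
apply: le_ereal_inf_tmp => _ [t /= [t0 Bt] <-]; rewrite lee_fin.
have [i it] := ex_jump_interval y (ltW t0).
apply: (@le_trans _ _ (jump_time i y)); last by case/andP: it.
by apply/jump_time_le/minm/asboolP; rewrite -(trajectory it).
Qed.

(** Up to the first jump after time [s] the path is outside of [B], so the reward
    telescopes to the loss of discount, which by then is larger than at [s]. *)
Lemma reward_before_hitting (B : set T) s o :
  (forall n, ~ B (Y n o) \/ s < jump_time n o) ->
  forall M n, jump_time n o <= s < jump_time (n + M) o ->
  discount n o - expR (- lambda * s) <=
  reward (~` B) (fun=> 1) M n o.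
Proof.
move=> h; elim=> [|M IH] n; first by rewrite addn0 => /andP[]; lra.
move=> /andP[ns sM] /=.
have nB : (~` B) (Y n o) by have [//|] := h n; lra.
rewrite indicE mem_set// !mul1r.
have [n1s|n1s] := leP (jump_time n.+1 o) s.
  have := IH n.+1; rewrite n1s addSnnS sM => /(_ isT); lra.
have a0 : 0 <= reward (~` B) (fun=> 1) M n.+1 o.
  exact: reward_ge0.
have : discount n.+1 o <= expR (- lambda * s).
  by rewrite discountE ler_expR !mulNr lerN2; apply: ler_wpM2l; exact: ltW.
lra.
Qed.

(** Markov's inequality for the loss of discount before [B] is visited: it is at
    least [1 - expR (- lambda * s)] on the event considered, as soon as the number
    of jumps is large enough for time [s] to be exceeded. *)
Lemma hitting_time_tail (B : set T) (f : T -> R) (s : R) : 0 < s ->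
  (forall x, 0 <= f x) ->
  (forall x, (~` B) x -> lambda + generator target rate f x <= lambda * f x) ->
  (P [set o | (s%:E < hitting_time U B o)%E] <=
   (f u / (1 - expR (- lambda * s)))%:E)%E.
Proof.
move=> s0 f0 sup; rewrite (hitting_time_gtE _ (ltW s0)).
set E := \bigcap_n _.
have c0 : 0 < 1 - expR (- lambda * s).
  by rewrite subr_gt0 expR_lt1 mulNr oppr_lt0 mulr_gt0.
have mgt n : measurable [set o | s < jump_time n o].
  rewrite (_ : [set _ | _] = jump_time n @^-1` `]s, +oo[).
    by rewrite -[X in measurable X]setTI; exact: measurable_jump_time.
  by apply/seteqP; split=> y /=; rewrite in_itv/= andbT.
have mE : measurable E.
  apply: bigcapT_measurable => n; apply: measurableU => //.
  exact: (measurable_state n (~` B)).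
pose F n := E `&` [set o | s < jump_time n o].
have mF n : measurable (F n) by exact: measurableI.
have EF : E = \bigcup_n F n.
  apply/seteqP; split=> y; last by case=> n _ [].
  by move=> Ey; have [n ns] := ex_jump_time_gt y s; exists n.
have : P \o F @ \oo --> P (\bigcup_n F n).
  apply: nondecreasing_cvg_mu => //; first by rewrite -EF.
  move=> m n mn; apply/subsetPset => y [Ey /= ym]; split=> //=.
  by apply: lt_le_trans ym _; exact: jump_time_le.
rewrite -EF => cvgF.
have PF n : (P (F n) <= (f u / (1 - expR (- lambda * s)))%:E)%E.
  have := integral_reward (D := ~` B) (r := fun=> 1) (fun=> ler01) f0 _ n.
  have sup1 x : (~` B) x -> lambda * 1 + generator target rate f x <= lambda * f x.
    by rewrite mulr1; exact: sup.
  move=> /(_ sup1).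
  have cF : ((1 - expR (- lambda * s))%:E * P (F n) <=
      \int[P]_o (reward (~` B) (fun=> 1) n 0 o)%:E)%E.
    rewrite -[F n]setIT -integral_indic// -ge0_integralZl//=; last 2 first.
    - exact/measurable_EFinP/measurable_indic.
    - by rewrite lee_fin ltW.
    apply: ge0_le_integral => //.
    - by move=> y _; rewrite -EFinM lee_fin mulr_ge0// ltW.
    - apply/measurable_EFinP/measurable_funM => //; exact: measurable_indic.
    - apply/measurable_EFinP; exact: measurable_reward.
    move=> y _; rewrite -EFinM lee_fin indicE.
    have [/set_mem[Ey yn]|_] := boolP (y \in F n); last first.
      by rewrite mulr0; exact: reward_ge0.
    rewrite mulr1; have := @reward_before_hitting B s y (fun i => Ey i I) n 0.
    rewrite jump_time0 add0n yn ltW// => /(_ isT).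
    by rewrite /discount big_ord0.
  move=> /(le_trans cF); rewrite -(@fineK _ (P (F n))) ?fin_num_measure//.
  by rewrite -EFinM !lee_fin ler_pdivlMr// mulrC.
apply: (cvge_to_le cvgF); exact: nearW.
Qed.

End trajectories.
End process.
End jump_paths.

(** * Invariant measures *)

Section invariant.
Context {R : realType} {d d' : measure_display} {T : measurableType d'}.
Context {J : finType} (target : J -> T -> T) (rate : J -> T -> R).
Hypothesis measurable_discrete : forall A : set T, measurable A.
Hypothesis countable_states : countable [set: T].
Hypothesis rate_ge0 : forall j x, 0 <= rate j x.
Hypothesis total_rate_gt0 : forall x, 0 < total_rate rate x.
Variables (Omega : T -> measurableType d).
Variables (P : forall u, probability (Omega u) R) (U : forall u, R -> Omega u -> T).
Arguments U : clear implicits.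
Hypothesis process : forall u, is_jump_process target rate u (P u) (U u).

Local Notation leb := (@lebesgue_measure R).

(** Started from an invariant measure, the process is in [B] with the same
    probability at all times, hence also at an independent exponential time. *)
Lemma invariant_measure_le (mu : probability T R) (B : set T) (lambda C : R)
    (f : T -> R) : invariant_measure P U mu -> 0 < lambda ->
  (forall x, 0 <= f x) -> (forall x, f x <= C) ->
  (forall x, lambda * \1_B x + generator target rate f x <= lambda * f x) ->
  (mu B <= C%:E)%E.
Proof.
move=> inv l0 f0 fC sup.
pose w t := (exponential_pdf lambda t : R).
have w0 t : 0 <= w t by rewrite exponential_pdf_ge0// ltW.
pose phi (z : T * R) : \bar R := ((w z.2)%:E * P z.1 [set o | B (U z.1 z.2 o)])%E.
have phi0 z : (0 <= phi z)%E by rewrite mule_ge0// lee_fin.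
have mphi : measurable_fun setT phi.
  move=> _ A mA; rewrite setTI.
  (* As [T] is countable and discrete, the measurability of the sections of [phi]
     is enough. *)
  have -> : phi @^-1` A = \bigcup_(u in [set: T])
      ([set u] `*` ((fun t => phi (u, t)) @^-1` A)).
    apply/seteqP; split=> [[u t] /= h|[u t] [v _ [/= -> ]]//].
    by exists u.
  apply: (countable_bigcupT_measurable countable_states) => u.
  apply: measurableX => //.
  have [Y [H [H0 div traj law]]] := process u.
  rewrite -[X in measurable X]setTI.
  have := measurable_discounted_occupation measurable_discrete H0 l0 div traj B.
  by move=> /(_ measurableT _ mA).
have swap := @fubini_tonelli _ _ _ _ R mu leb phi mphi phi0.
have inner t : (\int[mu]_u phi (u, t) = (w t)%:E * mu B)%E.
  have [t0|t0] := leP 0 t; last first.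
    rewrite /w lt0_exponential_pdf// mul0e; apply: integral0_eq => u _.
    by rewrite /phi /w lt0_exponential_pdf// mul0e.
  rewrite -(inv t B t0 (measurable_discrete B)) -ge0_integralZl//.
  exact: w0.
have occ u : (\int[leb]_t phi (u, t) <= C%:E)%E.
  have [Y [H [H0 div traj law]]] := process u.
  apply: (@le_trans _ _ (f u)%:E); last by rewrite lee_fin.
  exact: (discounted_occupation_le measurable_discrete rate_ge0 total_rate_gt0
    H0 law l0 div traj).
have -> : (mu B = \int[mu]_u \int[leb]_t phi (u, t))%E.
  rewrite swap; under eq_integral do rewrite inner muleC.
  rewrite ge0_integralZl//; last 2 first.
  - apply/measurable_EFinP; exact: measurable_exponential_pdf.
  - by move=> t _; rewrite lee_fin.
  by rewrite integral_exponential_pdf// mule1.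
apply: (@le_trans _ _ (\int[mu]_u C%:E)%E).
  by apply: ge0_le_integral => // u _; exact: integral_ge0.
have mu1 : (C%:E * mu [set: T] = C%:E)%E by rewrite probability_setT mule1.
by rewrite integral_cst// -[leRHS]mu1.
Qed.

Lemma generator_affine (l c : R) (g : T -> R) x :
  generator target rate (fun y => l * g y + c) x = l * generator target rate g x.
Proof. by rewrite /generator mulr_sumr; apply: eq_bigr => j _; ring. Qed.

End invariant.

(** * Dominant moves lead to ladder lists *)

Section dominant_moves.
Variables (N : nat) (hN : (3 <= N)%N).
Implicit Types (u : state hN) (j : 'I_N * bool) (s : bool) (a b : 'I_N).

Definition move j u : state hN := express j.1 j.2 u.

(** The entries counted positively when they agree with the opinion [s], so that
    the two opinions are treated alike. *)
Definition signed s u b : int := opinion_val s * val u b.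

(** The rate of the move [j] is [expR (beta * (intensity j u)%:~R)]. *)
Definition intensity j u : int := signed j.2 u j.1.

(** The moves of largest rate. Several moves may be dominant, even with different
    opinions. *)
Definition dominant u j : bool := [forall b, `|val u b| <= intensity j u].

Lemma opinion_valE s : opinion_val s = if s then 1 else - 1.
Proof. by []. Qed.

Lemma signed_le_abs s u b : signed s u b <= `|val u b|.
Proof. rewrite /signed opinion_valE; case: s; lia. Qed.

Lemma signedN s u b : signed (~~ s) u b = - signed s u b.
Proof. rewrite /signed !opinion_valE; case: s => /=; lia. Qed.

Lemma signed_moveE s j u b :
  signed s (move j u) b =
  if b == j.1 then 0 else signed s u b + (if s == j.2 then 1 else - 1).
Proof.
rewrite /signed /move /express /express_list /= ffunE !opinion_valE.
by case: eqP => _; case: s; case: (j.2) => /=; lia.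
Qed.

Lemma dominantP u j : dominant u j -> forall b, `|val u b| <= intensity j u.
Proof. by move=> /forallP. Qed.

Lemma ex_dominant u : exists j, dominant u j.
Proof.
have a0 : 'I_N by exact: (Ordinal (ltn_trans (isT : 0 < 2)%N hN)).
have [a _ amax] : exists2 a, true & forall b, `|val u b| <= `|val u a|.
  by case: (@arg_maxP _ _ 'I_N a0 xpredT (fun b => `|val u b|) isT) => a _ h;
    exists a => // b; exact: h.
exists (a, 0 <= val u a); apply/forallP => b; apply: le_trans (amax b) _.
by rewrite /intensity /signed /= opinion_valE; case: ifP; lia.
Qed.

Lemma ex_zero u : exists b, val u b = 0.
Proof.
have /existsP[b /eqP ub] := valP u.
by exists b; apply/eqP; rewrite -absz_eq0 ub.
Qed.

Lemma neq_null u : u != null_list hN -> exists b, val u b != 0.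
Proof.
move=> u0; apply: contrapT => h; move/eqP: u0; apply.
apply/val_inj/ffunP => b; rewrite ffunE; apply/eqP; apply: contrapT => /negP ub.
by apply: h; exists b.
Qed.

Lemma null_listE b : val (null_list hN) b = 0.
Proof. by rewrite ffunE. Qed.

Lemma nonzero_neq_null u b : val u b != 0 -> u != null_list hN.
Proof. by apply: contra_neq => ->; rewrite null_listE. Qed.

Lemma dominant_gt0 u j : u != null_list hN -> dominant u j -> 0 < intensity j u.
Proof. by move=> /neq_null[b ub] /dominantP/(_ b); lia. Qed.

Lemma nondominant_lt u j j0 :
  dominant u j0 -> ~~ dominant u j -> intensity j u <= intensity j0 u - 1.
Proof.
move=> dj0 /forallPn[b]; rewrite -ltNge => jb.
by have := dominantP dj0 b; lia.
Qed.

(** A list has an entry equal to 0, and a move that resets another entry makes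
    this one equal to 1 or -1. *)
Lemma move_neq_null u j : val u j.1 != 0 -> move j u != null_list hN.
Proof.
move=> uj; have [b ub] := ex_zero u.
have bj : b != j.1 by apply: contraNneq uj => <-; rewrite ub.
apply: (@nonzero_neq_null _ b).
rewrite /move /express /= ffunE (negbTE bj) ub opinion_valE.
by case: (j.2).
Qed.

Lemma dominant_move_neq_null u j :
  u != null_list hN -> dominant u j -> move j u != null_list hN.
Proof.
move=> u0 /(dominant_gt0 u0); rewrite /intensity /signed => h.
by apply: move_neq_null; apply: contraTneq h => ->; rewrite mulr0.
Qed.

Lemma move_null_neq_null j : move j (null_list hN) != null_list hN.
Proof.
have [b bj] : exists b : 'I_N, b != j.1.
  have : (0 < #|predC1 j.1|)%N by rewrite cardC1 card_ord; lia.
  by move=> /card_gt0P[b]; exists b.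
apply: (@nonzero_neq_null _ b).
rewrite /move /express /= !ffunE (negbTE bj) opinion_valE.
by case: (j.2).
Qed.

(** The wrong moves from a ladder list that keep its sign lead to lists of this
    kind, from which the return is as fast as the moves between ladder lists
    ([spread_max]). *)
Definition spread s u : Prop :=
  (forall b, 0 <= signed s u b) /\ injective (signed s u).

Definition ladder_of s u : Prop :=
  spread s u /\ forall b, signed s u b < N%:Z.

Lemma signed_surj_inj s u : (forall b, 0 <= signed s u b < N%:Z) ->
  (forall k, (k < N)%N -> exists b, signed s u b = k%:Z) ->
  injective (signed s u).
Proof.
move=> hb hk.
have lt b : (absz (signed s u b) < N)%N by have := hb b; lia.
pose g b := Ordinal (lt b).
have gs : #|codom g| = N.
  rewrite -[RHS]card_ord; apply: eq_card => k; rewrite [RHS]inE.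
  apply/codomP; have [b bk] := hk k (ltn_ord k).
  by exists b; apply: val_inj => /=; rewrite bk.
have gi : injective g.
  by apply/injectiveP/card_uniqP; rewrite gs size_codom card_ord.
move=> a b ab; apply: gi; apply: val_inj => /=; by rewrite ab.
Qed.

Lemma signed_inj_surj s u : (forall b, 0 <= signed s u b < N%:Z) ->
  injective (signed s u) ->
  forall k, (k < N)%N -> exists b, signed s u b = k%:Z.
Proof.
move=> hb inj k kN.
have lt b : (absz (signed s u b) < N)%N by have := hb b; lia.
pose g b := Ordinal (lt b).
have gi : injective g.
  move=> a b /(congr1 val) /= e; apply: inj.
  have := hb a; have := hb b; lia.
exists (invF gi (Ordinal kN)).
have := f_invF gi (Ordinal kN) => /(congr1 val) /=.
have := hb (invF gi (Ordinal kN)); lia.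
Qed.

(** Between two sets of cardinal N a map is injective when it is surjective. *)
Lemma ladder_ofP s u : ladder_of s u <->
  (forall b, signed s u b < N%:Z) /\ (forall b, 0 <= signed s u b) /\
  (forall k, (k < N)%N -> exists b, signed s u b = k%:Z).
Proof.
split=> [[[h0 hi] hn]|[hn [h0 hs]]].
  do 2!split=> //; apply: signed_inj_surj hi => b.
  by rewrite h0 hn.
split=> //; split=> //; apply: signed_surj_inj hs => b.
by rewrite h0 hn.
Qed.

Lemma ladderE u : ladder hN u <-> exists s, ladder_of s u.
Proof.
split.
  case=> /seteqP[h1 h2]; [exists true|exists false]; apply/ladder_ofP;
      (do 2?split) => [b|b|k kN].
  - have [k /= kN ku] : [set k%:Z | k in `I_N] (val u b) by apply: h1; exists b.
    by rewrite /signed -ku opinion_valE; lia.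
  - have [k /= kN ku] : [set k%:Z | k in `I_N] (val u b) by apply: h1; exists b.
    by rewrite /signed -ku opinion_valE; lia.
  - have [|b _ bk] := h2 k%:Z; first by exists k.
    by exists b; rewrite /signed bk opinion_valE; lia.
  - have [k /= kN ku] : [set - k%:Z | k in `I_N] (val u b)
      by apply: h1; exists b.
    by rewrite /signed -ku opinion_valE; lia.
  - have [k /= kN ku] : [set - k%:Z | k in `I_N] (val u b)
      by apply: h1; exists b.
    by rewrite /signed -ku opinion_valE; lia.
  - have [|b _ bk] := h2 (- k%:Z); first by exists k.
    by exists b; rewrite /signed bk opinion_valE; lia.
case=> s /ladder_ofP[hn [h0 hs]].
case: s hn h0 hs => hn h0 hs; [left|right]; apply/seteqP; split.
- move=> _ [b _ <-]; have := hn b; have := h0 b.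
  rewrite /signed opinion_valE; move: (val u b) => z z0 zN.
  by exists (absz z) => /=; lia.
- move=> _ [k /= kN <-]; have [b bk] := hs k kN; exists b => //.
  by move: bk; rewrite /signed opinion_valE /=; lia.
- move=> _ [b _ <-]; have := hn b; have := h0 b.
  rewrite /signed opinion_valE; move: (val u b) => z z0 zN.
  by exists (absz z) => /=; lia.
- move=> _ [k /= kN <-]; have [b bk] := hs k kN; exists b => //.
  by move: bk; rewrite /signed opinion_valE /=; lia.
Qed.

(** The other entries stay distinct and become positive. *)
Lemma spread_move s u j : spread s u -> j.2 = s -> spread s (move j u).
Proof.
move=> [h0 hi] js; split=> [b|a b]; rewrite !signed_moveE js eqxx.
  by case: eqP => // _; have := h0 b; lia.
have := h0 a; have := h0 b.
by do 2 case: eqP => [->|_] //; try lia; move=> _ _ e; apply: hi; lia.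
Qed.

Lemma spread_neq_null s u : spread s u -> u != null_list hN.
Proof.
move=> [_ hi]; apply/eqP => u0.
have h : (0 < N)%N by lia.
have h' : (1 < N)%N by lia.
suff : Ordinal h = Ordinal h' by move=> /(congr1 val).
by apply: hi; rewrite /signed u0 !null_listE.
Qed.

(** Among N distinct nonnegative integers, one is at least N-1. *)
Lemma spread_max s u j : spread s u -> dominant u j -> N.-1%:Z <= intensity j u.
Proof.
move=> [h0 hi] dj; rewrite leNgt; apply/negP => jN.
have le b : 0 <= signed s u b < N%:Z - 1.
  by have := h0 b; have := dominantP dj b; have := signed_le_abs s u b; lia.
have le' b : 0 <= signed s u b < N%:Z by have := le b; lia.
have N1 : (N.-1 < N)%N by lia.
have [b] := signed_inj_surj le' hi N1.
by have := le b; lia.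
Qed.

Lemma dominant_sign s u j : u != null_list hN ->
  (forall b, 0 <= signed s u b) -> dominant u j -> j.2 = s.
Proof.
move=> u0 h0 /(dominant_gt0 u0); rewrite /intensity.
have [//|js] := eqVneq j.2 s; have -> : j.2 = ~~ s by move: js; case: (j.2) s {h0} => -[].
by rewrite signedN; have := h0 j.1; lia.
Qed.

Lemma ladder_move s u j : ladder_of s u -> dominant u j ->
  ladder_of s (move j u).
Proof.
move=> [sp hN1] dj; have u0 := spread_neq_null sp.
have js := dominant_sign u0 sp.1 dj.
split; first exact: spread_move.
have jm := spread_max sp dj; move: (jm); rewrite /intensity js => jm'.
move=> b; rewrite signed_moveE js eqxx; case: eqP => [_|bj]; first by lia.
have : signed s u b != signed s u j.1 by apply/eqP => /sp.2.
by have := hN1 b; have := hN1 j.1; lia.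
Qed.

Lemma opposite_intensity s u j :
  (forall b, 0 <= signed s u b) -> j.2 = ~~ s -> intensity j u <= 0.
Proof. by move=> h0 js; rewrite /intensity js signedN oppr_le0. Qed.

Lemma ladder_nondominant s u j : ladder_of s u -> ~~ dominant u j ->
  intensity j u <= N.-1%:Z - 1.
Proof.
move=> [su hN1] ndj; have [j0 dj0] := ex_dominant u.
have := nondominant_lt dj0 ndj; have := hN1 j0.1.
rewrite /intensity (dominant_sign (spread_neq_null su) su.1 dj0); lia.
Qed.

(** Every sequence of dominant moves from [u], whatever the choices between ties,
    visits a ladder list within [k] moves. *)
Fixpoint absorbed k u : Prop :=
  ladder hN u \/
  if k is k'.+1 then forall j, dominant u j -> absorbed k' (move j u) else False.

Lemma absorbed_ladder k u : ladder hN u -> absorbed k u.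
Proof. by case: k => [|k] /=; left. Qed.

Lemma absorbedS k u : absorbed k u -> absorbed k.+1 u.
Proof.
elim: k u => [u [//|//]|k IH u [L|h]]; first exact: absorbed_ladder.
  exact: absorbed_ladder.
by right => j dj; apply: IH; exact: h.
Qed.

Lemma absorbed_leq k k' u : (k <= k')%N -> absorbed k u -> absorbed k' u.
Proof.
move=> /subnK <-; elim: (k' - k)%N => // n IH h.
by rewrite addSn; apply: absorbedS; exact: IH.
Qed.

Lemma card_full (S : {set 'I_N}) : #|S| = N -> forall b, b \in S.
Proof.
move=> h b; have := cardsC S; rewrite h card_ord => /eqP.
rewrite -[X in _ == X]addn0 eqn_add2l cards_eq0 => /eqP/setP/(_ b).
by rewrite !inE => /negbFE.
Qed.

(** [S] is the set of the actors reset so far. Their entries are smaller than the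
    others, so that a dominant move resets a new actor, and they are equal to 0,
    ..., t - 1 since one actor is reset at each move. *)
Lemma absorbed_same_sign s u n t (S : {set 'I_N}) :
  u != null_list hN -> (t + n = N)%N -> #|S| = t ->
  (forall b, b \in S -> 0 <= signed s u b < t%:Z) ->
  (forall b, b \notin S -> t%:Z <= signed s u b) ->
  (forall k, (k < t)%N -> exists b, signed s u b = k%:Z) ->
  absorbed n u.
Proof.
elim: n u t S => [|n IH] u t S u0 tn St hin hout hs.
  have tN : t = N by lia.
  have ST b : b \in S by apply: card_full; rewrite St.
  apply: absorbed_ladder; apply/ladderE; exists s; apply/ladder_ofP.
  rewrite tN in hin hs; split=> [b|]; last split=> // b.
    by have /andP[] := hin b (ST b).
  by have /andP[] := hin b (ST b).
right => j dj.
have h0 b : 0 <= signed s u b.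
  by have [/hin/andP[]//|/hout] := boolP (b \in S); lia.
have js := dominant_sign u0 h0 dj.
have jS : j.1 \notin S.
  apply/negP => /hin/andP[_ jt].
  have [b bS] : exists b, b \notin S.
    apply: contrapT => h; have : #|S| = N; last by rewrite St; lia.
    rewrite -[RHS]card_ord; apply: eq_card => b; rewrite [RHS]inE.
    by apply: contrapT => /negP bS; apply: h; exists b.
  have := hout _ bS; have := dominantP dj b; have := signed_le_abs s u b.
  by rewrite /intensity js; lia.
apply: (IH _ t.+1 (j.1 |: S)%SET).
- exact: dominant_move_neq_null.
- by lia.
- by rewrite cardsU1 jS St.
- move=> b; rewrite !inE signed_moveE js eqxx; case: eqP => [//|_] /= bS.
  by have := hin b bS; lia.
- move=> b; rewrite !inE signed_moveE js eqxx; case: eqP => [//|_] /= bS.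
  by have := hout b bS; lia.
- case=> [_|k kt]; first by exists j.1; rewrite signed_moveE eqxx.
  have [//|b bk] := hs k; exists b.
  rewrite signed_moveE js eqxx; case: eqP => [bj|_]; last by lia.
  by have := hout _ jS; rewrite -bj; lia.
Qed.

(** The hypothesis bounds by [k] the entries of one of the two signs. A dominant
    move with the other opinion decreases them by 1; a dominant move with their
    opinion shows that the entries of the other sign are bounded by [k] as well,
    and decreases these by 1. So [k] decreases at each move, and at 0 all entries
    have the same sign. *)
Lemma absorbed_one_sided s u k : u != null_list hN ->
  (forall b, - k%:Z <= signed s u b) -> absorbed (k + N) u.
Proof.
elim: k s u => [|k IH] s u u0 hk.
  apply: (@absorbed_same_sign s u N 0%N finset.set0) => //; first by rewrite cards0.
    by move=> b; rewrite inE.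
right => j dj.
have v0 := dominant_move_neq_null u0 dj.
have [js|js] := eqVneq j.2 s.
  apply: (IH s) => // b; rewrite signed_moveE js eqxx.
  by case: eqP => _; have := hk b; lia.
have {}js : j.2 = ~~ s by move: js; case: (j.2) s {hk} => -[].
apply: (IH (~~ s)) => // b; rewrite signed_moveE js eqxx.
case: eqP => _; first by lia.
have := dominantP dj b; have := signed_le_abs s u b; rewrite /intensity js !signedN.
by have := hk j.1; lia.
Qed.

(** [S] is the set of the actors reset so far, [t] the number of moves. As long as
    some entry exceeds [t] in absolute value, a dominant move resets a new actor,
    and this may happen [N] times at most. *)
Lemma absorbed_reset u n t (S : {set 'I_N}) :
  u != null_list hN -> (t + n = N)%N -> #|S| = t ->
  (forall b, b \in S -> `|val u b| < t%:Z) -> absorbed (n + (N + N)) u.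
Proof.
have small (v : state hN) k : v != null_list hN -> (k <= N)%N ->
    (forall b, `|val v b| <= k%:Z) -> absorbed (N + N) v.
  move=> v0 kN hk; apply: (@absorbed_one_sided true) => // b.
  have := hk b; rewrite /signed opinion_valE; lia.
elim: n u t S => [|n IH] u t S u0 tn St hin.
  apply: (small u t) => // [|b]; first by lia.
  by apply/ltW/hin/card_full; rewrite St; lia.
have [h|/existsNP[b0 /negP]] := pselect (forall b, `|val u b| <= t%:Z).
  by apply: (@absorbed_leq (N + N)); [lia|apply: (small u t) => //; lia].
rewrite -ltNge => b0t; right => j dj.
have jS : j.1 \notin S.
  apply/negP => /hin jt; have := le_trans (dominantP dj b0) (signed_le_abs _ _ _).
  move: b0t jt; move: (val u b0) (val u j.1) => y z; lia.
apply: (IH _ t.+1 (j.1 |: S)%SET).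
- exact: dominant_move_neq_null.
- by lia.
- by rewrite cardsU1 jS St.
move=> b; rewrite !inE /move /express /= ffunE; case: eqP => [_ _|_ /hin].
  by rewrite normr0.
by rewrite opinion_valE; move: (val u b) => z; case: (j.2); lia.
Qed.

Lemma absorbed_neq_null u : u != null_list hN -> absorbed (3 * N) u.
Proof.
move=> u0; have := @absorbed_reset u N 0%N finset.set0 u0.
rewrite (_ : (3 * N = N + (N + N))%N); last by lia.
by apply => // [|b]; rewrite ?cards0// inE.
Qed.

(** As [absorbed] is monotone in [k], and holds at [3 * N] for a nonzero list, this
    is the smallest [k] such that [absorbed k u]. *)
Definition depth u : nat := \sum_(k < 3 * N) ~~ `[< absorbed k u >].

Lemma depth_le u : (depth u <= 3 * N)%N.
Proof.
rewrite /depth -[leqRHS](card_ord (3 * N)) -sum1_card.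
by apply: leq_sum => k _; exact: leq_b1.
Qed.

Lemma depth_ladder u : ladder hN u -> depth u = 0%N.
Proof.
move=> L; rewrite /depth big1// => k _.
by rewrite asboolT//; exact: absorbed_ladder.
Qed.

(** Since [absorbed k.+1 u] implies [absorbed k (move j u)], the terms of the sum
    for [move j u] are at most those for [u] shifted by one index; the shift drops
    the term of index 0, which is 1 off the ladder, and adds one that is 0. *)
Lemma depth_move u j : u != null_list hN -> ~ ladder hN u -> dominant u j ->
  (depth (move j u) < depth u)%N.
Proof.
move=> u0 nL dj.
have -> : (depth u = (depth u + ~~ `[< absorbed (3 * N) u >])%N).
  by rewrite asboolT ?addn0//; exact: absorbed_neq_null.
rewrite /depth.
have -> : (\sum_(k < 3 * N) ~~ `[< absorbed k u >] + ~~ `[< absorbed (3 * N) u >]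
  = \sum_(k < (3 * N).+1) ~~ `[< absorbed k u >])%N by rewrite big_ord_recr.
have n0 : ~ absorbed (@ord0 (3 * N)) u by move=> /= [].
rewrite big_ord_recl (asboolF n0) [X in (X + _)%N]/= add1n ltnS; apply: leq_sum => k _.
rewrite lift0.
have [/asboolP h|_] := boolP `[< absorbed k.+1 u >]; last exact: leq_b1.
rewrite asboolT//=; case: h => // h; exact: h.
Qed.

End dominant_moves.

(** * A Lyapunov function *)

Section lyapunov.
Variables (R : realType) (N : nat) (hN : (3 <= N)%N) (beta : R).
Implicit Types (u : state hN) (j : 'I_N * bool) (s : bool).

Definition move_rate j u : R := express_rate beta j.1 j.2 u.

Let x := expR (- beta).
Let A : R := (2 * N + 2)%:R.
Let K : R := (3 * N)%:R.

(** A bound, up to constants, on the expected time to reach a ladder list. The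
    factor [A] makes one dominant move outweigh the [2 * N] moves. *)
Definition potential u : R :=
  if u == null_list hN then 1 else
  A * (depth u)%:R * (if `[< exists s, spread s u >] then x ^+ N.-1 else x).

Hypothesis beta0 : 0 <= beta.

Let x0 : 0 < x. Proof. exact: expR_gt0. Qed.
Let x1 : x <= 1. Proof. by rewrite /x expR_le1 oppr_le0. Qed.
Let A0 : 0 < A. Proof. by rewrite ltr0n; lia. Qed.
Let K0 : 0 <= K. Proof. by rewrite ler0n. Qed.
Let xN : x ^+ N.-1 <= x.
Proof.
rewrite -[leRHS]expr1; apply: ler_wiXn2l => //; first exact: ltW.
by lia.
Qed.

Lemma move_rateE j u : move_rate j u = expR (beta * (intensity j u)%:~R).
Proof. by []. Qed.

Lemma move_rate_gt0 j u : 0 < move_rate j u.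
Proof. exact: expR_gt0. Qed.

Lemma move_rate_le j u m : intensity j u <= m ->
  move_rate j u <= expR (beta * m%:~R).
Proof. by move=> h; rewrite move_rateE ler_expR ler_wpM2l// ler_int. Qed.

Lemma expR_int_ge1 (m : int) : 0 <= m -> 1 <= expR (beta * m%:~R).
Proof.
by move=> m0; rewrite -[leLHS]expR0 ler_expR; apply: mulr_ge0; rewrite ?ler0z.
Qed.

Lemma move_rate_le1 j u : intensity j u <= 0 -> move_rate j u <= 1.
Proof. by move=> /move_rate_le; rewrite mulr0z mulr0 expR0. Qed.

Lemma potential_null : potential (null_list hN) = 1.
Proof. by rewrite /potential eqxx. Qed.

Lemma potential_neq_null u : u != null_list hN ->
  potential u = A * (depth u)%:R *
    (if `[< exists s, spread s u >] then x ^+ N.-1 else x).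
Proof. by rewrite /potential => /negbTE ->. Qed.

Lemma potential_ge0 u : 0 <= potential u.
Proof.
rewrite /potential; case: ifP => // _; rewrite !mulr_ge0 ?ler0n//.
by case: ifP => _; rewrite ?exprn_ge0 ?ltW.
Qed.

Lemma potential_spread s u : spread s u ->
  potential u = A * (depth u)%:R * x ^+ N.-1.
Proof.
move=> su; rewrite potential_neq_null ?asboolT//; first by exists s.
exact: spread_neq_null su.
Qed.

Lemma depth_leK u : (depth u)%:R <= K.
Proof. by rewrite ler_nat depth_le. Qed.

Lemma potential_spread_le s u : spread s u -> potential u <= A * K * x ^+ N.-1.
Proof.
move=> /potential_spread ->; apply: ler_wpM2r.
  by rewrite exprn_ge0 ?ltW.
by rewrite ler_wpM2l ?depth_leK// ltW.
Qed.

Lemma potential_le_depth u : u != null_list hN ->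
  potential u <= A * (depth u)%:R * x.
Proof.
move=> /potential_neq_null ->; apply: ler_wpM2l.
  by rewrite mulr_ge0 ?ler0n// ltW.
by case: ifP.
Qed.

Lemma potential_le u : u != null_list hN -> potential u <= A * K * x.
Proof.
move=> /potential_le_depth /le_trans; apply; apply: ler_wpM2r; first exact: ltW.
by rewrite ler_wpM2l ?depth_leK// ltW.
Qed.

Hypothesis small : A * K * x <= 1 / 2.

Lemma potential_le1 u : potential u <= 1.
Proof.
have [->|/potential_le] := eqVneq u (null_list hN); first by rewrite potential_null.
by move=> /le_trans; apply; apply: le_trans small _; lra.
Qed.

Lemma potential_ladder u : ladder hN u -> potential u = 0.
Proof.
move=> L; have /ladderE[s [su _]] := L.
by rewrite (potential_spread su) depth_ladder// mulr0 mul0r.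
Qed.

Let G := generator (@move N hN) move_rate potential.

Lemma generator_le (f : state hN -> R) u j0 y z : 0 <= y ->
  (forall j, move_rate j u * (f (move j u) - f u) <= y) ->
  move_rate j0 u * (f (move j0 u) - f u) <= - z ->
  generator (@move N hN) move_rate f u <= (2 * N)%:R * y - z.
Proof.
move=> y0 hj hj0; rewrite /generator (bigD1 j0)//= addrC lerD//.
apply: (@le_trans _ _ (\sum_(j | j != j0) y)); first by apply: ler_sum => j _.
apply: (@le_trans _ _ (\sum_(j : 'I_N * bool) y)).
  by rewrite [leRHS](bigD1 j0)//= lerDr.
by rewrite sumr_const card_prod card_ord card_bool [(N * 2)%N]mulnC mulr_natl.
Qed.

Lemma generator_null : G (null_list hN) <= - 1.
Proof.
have [j0 _] := ex_dominant (null_list hN).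
rewrite /G /generator; apply: (@le_trans _ _ (\sum_(j : 'I_N * bool) - (1 / 2))).
  apply: ler_sum => j _.
  rewrite potential_null move_rateE /intensity /signed null_listE.
  rewrite mulr0 mulr0 expR0 mul1r.
  by have := potential_le (move_null_neq_null hN j); move: small; lra.
rewrite sumr_const card_prod card_ord card_bool -[leLHS]mulr_natl natrM.
have N3 : 3 <= N%:R :> R by rewrite ler_nat.
by lra.
Qed.

Lemma potential_dominant_move u j : u != null_list hN -> ~ ladder hN u ->
  dominant u j ->
  potential (move j u) - potential u <=
    - A * (if `[< exists s, spread s u >] then x ^+ N.-1 else x).
Proof.
move=> u0 nL dj; have v0 := dominant_move_neq_null u0 dj.
have dd : (depth (move j u))%:R + 1 <= (depth u)%:R :> R.
  by rewrite natr1 ler_nat; exact: depth_move.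
rewrite (potential_neq_null u0); case: asboolP => [[s su]|_].
  have js := dominant_sign u0 su.1 dj.
  rewrite (potential_spread (spread_move su js)).
  have c0 : 0 <= A * x ^+ N.-1 by rewrite mulr_ge0 ?exprn_ge0 ?ltW.
  by have := ler_wpM2l c0 dd; lra.
have c0 : 0 <= A * x by rewrite mulr_ge0 ?ltW.
by have := ler_wpM2l c0 dd; have := potential_le_depth v0; lra.
Qed.

Lemma expR_xM m : x * expR (beta * m%:~R) = expR (beta * (m - 1)%:~R).
Proof. by rewrite /x -expRD intrD; congr expR; rewrite mulrDr mulrN1 addrC. Qed.

Lemma xX_expR n m : x ^+ n * expR (beta * m%:~R) = expR (beta * (m - n%:Z)%:~R).
Proof.
elim: n m => [|n IH] m; first by rewrite expr0 mul1r subr0.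
by rewrite exprS mulrAC expR_xM mulrC IH -addrA -opprD.
Qed.

Lemma potential_sub_le1 u v : potential v - potential u <= 1.
Proof. by have := potential_le1 v; have := potential_ge0 u; lra. Qed.

Lemma mulr_le_bound (a b c d : R) : 0 <= a -> 0 <= d -> a <= c -> b <= d ->
  a * b <= c * d.
Proof.
move=> a0 d0 ac bd; apply: (@le_trans _ _ (a * d)); first exact: ler_wpM2l.
exact: ler_wpM2r.
Qed.

Lemma dominant_le0 u j : u != null_list hN -> ~ ladder hN u -> dominant u j ->
  move_rate j u * (potential (move j u) - potential u) <= 0.
Proof.
move=> u0 nL dj; apply: mulr_ge0_le0; first exact: expR_ge0.
apply: le_trans (potential_dominant_move u0 nL dj) _.
rewrite mulNr oppr_le0 mulr_ge0 ?ltW//.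
by case: ifP => _; rewrite ?exprn_gt0.
Qed.

Let AN : A = (2 * N)%:R + 2.
Proof. by rewrite /A natrD. Qed.

(** Let [y] be the rate of a dominant move, times x ^+ N.-1 for a spread list and
    times x for another one. Any dominant move contributes [- A * y] at most to the
    generator, since it decreases the depth. Each other move contributes [y] at
    most: it is slower by a factor x; and on a spread list it either keeps the
    entries spread, so that the potential stays of order x ^+ N.-1, or has the
    opposite opinion and then a rate at most 1. *)
Lemma generator_off_ladder u : ~ ladder hN u -> G u <= - 1.
Proof.
move=> nL; have [->|u0] := eqVneq u (null_list hN); first exact: generator_null.
have [j0 dj0] := ex_dominant u.
have j0gt := dominant_gt0 u0 dj0.
suff [y [y1 hj hj0]] : exists y, [/\ 1 <= y,
    forall j, move_rate j u * (potential (move j u) - potential u) <= y &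
    move_rate j0 u * (potential (move j0 u) - potential u) <= - (A * y)].
  have y0 : 0 <= y by apply: le_trans y1.
  by have := generator_le y0 hj hj0; rewrite -/G AN; lra.
have d0 := potential_dominant_move u0 nL dj0.
move: d0; case: asboolP => [[s su]|_] d0; last first.
  exists (expR (beta * (intensity j0 u - 1)%:~R)); split.
  - by apply: expR_int_ge1; rewrite subr_ge0 -gtz0_ge1.
  - move=> j; have [dj|ndj] := boolP (dominant u j).
      by apply: le_trans (dominant_le0 u0 nL dj) _; exact: expR_ge0.
    rewrite -[leRHS]mulr1; apply: mulr_le_bound => //; first exact: expR_ge0.
      exact/move_rate_le/nondominant_lt.
    exact: potential_sub_le1.
  - rewrite -expR_xM; have := ler_wpM2l (ltW (move_rate_gt0 j0 u)) d0.
    by rewrite move_rateE; lra.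
have jm := spread_max su dj0.
exists (x ^+ N.-1 * expR (beta * (intensity j0 u)%:~R)); split.
- by rewrite xX_expR; apply: expR_int_ge1; rewrite subr_ge0.
- move=> j; have [dj|ndj] := boolP (dominant u j).
    apply: le_trans (dominant_le0 u0 nL dj) _.
    by rewrite xX_expR; exact: expR_ge0.
  have [js|js] := eqVneq j.2 s.
    apply: (@le_trans _ _ (expR (beta * (intensity j0 u - 1)%:~R) *
                           (A * K * x ^+ N.-1))).
      apply: mulr_le_bound; first exact: expR_ge0.
      - by rewrite !mulr_ge0 ?exprn_ge0 // ltW.
      - exact/move_rate_le/nondominant_lt.
      - have := potential_spread_le (spread_move su js).
        by have := potential_ge0 u; lra.
    rewrite -expR_xM.
    have e0 : 0 <= expR (beta * (intensity j0 u)%:~R) * x ^+ N.-1.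
      by rewrite mulr_ge0 ?expR_ge0 ?exprn_ge0 ?ltW.
    by have := ler_wpM2r e0 small; lra.
  have {}js : j.2 = ~~ s by move: js; case: (j.2) s {su} => -[].
  apply: (@le_trans _ _ (1 * 1)).
    apply: mulr_le_bound => //; first exact: expR_ge0.
    + exact: move_rate_le1 (opposite_intensity su.1 js).
    + exact: potential_sub_le1.
  by rewrite mulr1 xX_expR; apply: expR_int_ge1; rewrite subr_ge0.
- have := ler_wpM2l (ltW (move_rate_gt0 j0 u)) d0.
  by rewrite move_rateE; lra.
Qed.

(** The dominant moves from a ladder list stay on the ladder. The other moves with
    the opinion of the list have rate at most [expR (beta * (N - 2))] and keep the
    entries spread; those with the opposite opinion have rate at most 1. *)
Lemma generator_ladder u : ladder hN u -> G u <= (2 * N)%:R * (A * K * x).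
Proof.
move=> L; have [s Ls] : exists s, ladder_of s u by apply/ladderE.
have [j0 dj0] := ex_dominant u.
have AKx : 0 <= A * K * x by rewrite !mulr_ge0// ltW.
have su := Ls.1; have u0 := spread_neq_null su.
have dom0 j : dominant u j -> potential (move j u) = 0.
  move=> dj; apply: potential_ladder; apply/ladderE.
  by exists s; exact: ladder_move Ls dj.
rewrite -[leRHS]subr0; apply: (@generator_le _ _ j0) => //; last first.
  by rewrite dom0// potential_ladder// subr0 mulr0 oppr0.
move=> j; rewrite (potential_ladder L) subr0.
have [dj|ndj] := boolP (dominant u j); first by rewrite dom0// mulr0.
have [js|js] := eqVneq j.2 s.
  apply: (@le_trans _ _ (expR (beta * (N.-1%:Z - 1)%:~R) *
                         (A * K * x ^+ N.-1))).
    apply: mulr_le_bound; first exact: expR_ge0.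
    - by rewrite !mulr_ge0 ?exprn_ge0 // ltW.
    - exact/move_rate_le/(ladder_nondominant Ls).
    - exact: potential_spread_le (spread_move su js).
  rewrite -expR_xM; set e := expR _.
  have -> : x * e * (A * K * x ^+ N.-1) = (x ^+ N.-1 * e) * (A * K * x) by ring.
  by rewrite xX_expR subrr mulr0 expR0 mul1r.
have {}js : j.2 = ~~ s by move: js; case: (j.2) s {Ls su} => -[].
rewrite -[leRHS]mul1r; apply: mulr_le_bound => //; first exact: expR_ge0.
- exact: move_rate_le1 (opposite_intensity su.1 js).
apply: potential_le; have [uj|] := eqVneq (val u j.1) 0; last exact: move_neq_null.
(* If the entry equal to 0 is the one reset, the entry equal to 2 becomes 1. *)
have /ladder_ofP[_ [_ /(_ 2%N hN)[b b2]]] := Ls.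
have bj : b != j.1.
  by apply: contraTneq isT => bj; move: b2; rewrite bj /signed uj mulr0.
have : signed s (move j u) b = 1.
  by rewrite signed_moveE (negbTE bj) b2 js; case: (s).
by apply: contra_eqN => /eqP ->; rewrite /signed null_listE mulr0.
Qed.

End lyapunov.

Section opinion_process.
Context (R : realType) (N : nat) (hN : (3 <= N)%N).
Let A : R := (2 * N + 2)%:R.
Let K : R := (3 * N)%:R.

Lemma total_move_rate_gt0 beta (u : state hN) : 0 < total_rate (@move_rate R N hN beta) u.
Proof.
have [j0 _] := ex_dominant u.
rewrite /total_rate (bigD1 j0)//= ltr_pwDl ?move_rate_gt0//.
by apply: sumr_ge0 => j _; rewrite ltW// move_rate_gt0.
Qed.

Lemma countable_state : countable [set: state hN].
Proof. exact: countableP. Qed.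

Lemma invariant_off_ladder beta : 0 <= beta -> A * K * expR (- beta) <= 1 / 2 ->
  forall (d : measure_display) (Omega : state hN -> measurableType d)
    (P : forall u, probability (Omega u) R)
    (U : forall u, R -> Omega u -> state hN),
    (forall u, is_opinion_process beta u (P u) (U u)) ->
  forall mu : probability (state hN) R, invariant_measure P U mu ->
  (mu (~` ladder hN) <=
   (expR (- beta) + (2 * N)%:R * (A * K * expR (- beta)))%:E)%E.
Proof.
move=> b0 small d Omega P U proc mu inv.
set x := expR (- beta); set c := _ * (A * K * x).
have x0 : 0 < x by exact: expR_gt0.
have c0 : 0 <= c by rewrite /c !mulr_ge0 ?ler0n// ltW.
(* The constant [c] absorbs the positive part of the generator on the ladder. *)
pose f (u : state hN) := x * potential beta u + c : R.
have rate0 j (v : state hN) : 0 <= move_rate beta j v by rewrite ltW// move_rate_gt0.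
have := @invariant_measure_le R d _ (state hN) _ (@move N hN) (@move_rate R N hN beta)
  (fun _ => I) countable_state rate0 (total_move_rate_gt0 beta) Omega P U proc
  mu (~` ladder hN) x (x + c) f inv x0.
apply => //.
- by move=> u; rewrite /f addr_ge0// mulr_ge0 ?potential_ge0// ltW.
- move=> u; rewrite /f lerD2r -[leRHS]mulr1 ler_pM2l//.
  exact: potential_le1.
move=> u; rewrite generator_affine -mulrDr ler_pM2l//.
have pu := potential_ge0 beta u.
have xp : 0 <= x * potential beta u by rewrite mulr_ge0 ?pu// ltW.
have [L|nL] := pselect (ladder hN u).
  have := generator_ladder b0 L; rewrite indicE memNset ?add0r; last by [].
  by rewrite -/A -/K -/x -/c /f; lra.
have := generator_off_ladder b0 small nL; rewrite indicE mem_set//= /f; lra.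
Qed.

Lemma hitting_ladder_tail beta : 0 <= beta -> A * K * expR (- beta) <= 1 / 2 ->
  forall (d : measure_display) (u : state hN) (Omega : measurableType d)
    (P : probability Omega R) (U : R -> Omega -> state hN),
    is_opinion_process beta u P U -> u != null_list hN ->
  forall delta : R,
  (P [set w | ((expR (- beta * (1 - delta)))%:E < hitting_time U (ladder hN) w)%E]
   <= (2 * A * K * expR (- (beta * delta)))%:E)%E.
Proof.
move=> b0 small d u Omega P U [Y [H [H0 div traj law]]] u0 delta.
set s := expR _.
(* A discount rate inverse to [s] makes [1 - expR (- l * s)] a constant. *)
pose l := expR (beta * (1 - delta)).
have l0 : 0 < l by exact: expR_gt0.
have ls : l * s = 1 by rewrite /l /s -expRD mulNr subrr expR0.
pose f (v : state hN) := l * potential beta v + 0 : R.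
have rate0 j (v : state hN) : 0 <= move_rate beta j v by rewrite ltW// move_rate_gt0.
have f0 v : 0 <= f v by rewrite /f addr0 mulr_ge0 ?potential_ge0// ltW.
have sup v : (~` ladder hN) v ->
    l + generator (@move N hN) (@move_rate R N hN beta) f v <= l * f v.
  move=> nL; rewrite generator_affine.
  have := ler_wpM2l (ltW l0) (generator_off_ladder b0 small nL).
  have : 0 <= l * f v by rewrite mulr_ge0// ltW.
  lra.
have discrete (S : set (state hN)) : measurable S by [].
have := hitting_time_tail discrete rate0 (total_move_rate_gt0 beta) H0 law l0
  div traj (expR_gt0 (- beta * (1 - delta))) f0 sup.
move=> /le_trans; apply; rewrite lee_fin.
rewrite -/s mulNr ls.
have e2 : expR (- 1) <= 1 / 2 :> R.
  rewrite expRN div1r lef_pV2 ?posrE ?expR_gt0//.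
  by have := expR_ge1Dx (1 : R); lra.
rewrite ler_pdivrMr; last by lra.
have : f u <= A * K * expR (- (beta * delta)).
  rewrite /f addr0 (_ : expR (- (beta * delta)) = l * expR (- beta)).
    by have := ler_wpM2l (ltW l0) (potential_le b0 u0); rewrite -/A -/K; lra.
  by rewrite /l -expRD; congr expR; ring.
have : 0 <= A * K * expR (- (beta * delta)) by rewrite !mulr_ge0 ?ler0n ?expR_ge0.
nra.
Qed.

End opinion_process.

(** * Proof *)

Theorem theorem2 (R : realType) (N : nat) (hN : (3 <= N)%N) :
  (exists C : R, 0 < C /\
    forall beta : R, 0 <= beta ->
    forall (d : measure_display) (Omega : state hN -> measurableType d)
      (P : forall u, probability (Omega u) R)
      (U : forall u, R -> Omega u -> state hN),
      (forall u, is_opinion_process beta u (P u) (U u)) ->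
    forall mu : probability (state hN) R, invariant_measure P U mu ->
      ((1 - C * expR (- beta))%:E <= mu (ladder hN))%E) /\
  (forall (d : measure_display) (Omega : R -> state hN -> measurableType d)
      (P : forall beta u, probability (Omega beta u) R)
      (U : forall beta u, R -> Omega beta u -> state hN),
      (forall (beta : R) (u : state hN), 0 <= beta ->
        is_opinion_process beta u (P beta u) (U beta u)) ->
    forall delta : R, 0 < delta ->
      ereal_sup
        [set P beta u [set w |
            ((expR (- beta * (1 - delta)))%:E <
             hitting_time (U beta u) (ladder hN) w)%E]
        | u in [set u : state hN | u != null_list hN]]
      @[beta --> +oo] --> 0%E).
Proof.
pose A : R := (2 * N + 2)%:R; pose K : R := (3 * N)%:R.
have A0 : 0 <= A by rewrite ler0n.
have K0 : 0 <= K by rewrite ler0n.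
split.
  (* The last term makes the lower bound nonpositive when [expR (- beta)] is not
     small. *)
  exists (1 + (2 * N)%:R * (A * K) + 2 * (A * K)).
  have AK0 : 0 <= A * K by rewrite mulr_ge0.
  have NAK0 : 0 <= (2 * N)%:R * (A * K) by rewrite mulr_ge0.
  split; first by lra.
  move=> beta b0 d Omega P U proc mu inv.
  have x0 : 0 < expR (- beta) by exact: expR_gt0.
  have [small|large] := leP (A * K * expR (- beta)) (1 / 2).
    have := invariant_off_ladder b0 small proc inv.
    rewrite probability_setC// -(@fineK _ (mu (ladder hN))) ?fin_num_measure//.
    rewrite -EFinB !lee_fin -/A -/K => h.
    have : 0 <= A * K * expR (- beta) by rewrite mulr_ge0// ltW.
    by move: h; nra.
  apply: (@le_trans _ _ 0%E); last exact: measure_ge0.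
  rewrite lee_fin.
  have : 0 <= (2 * N)%:R * (A * K) * expR (- beta) by rewrite mulr_ge0// ltW.
  lra.
move=> d Omega P U proc delta delta0.
apply: (@squeeze_cvge _ _ _ _ (cst 0%E) _
  (fun beta => (2 * A * K * expR (- (beta * delta)))%:E)).
- have ev : \forall beta \near +oo, A * K * expR (- beta) <= 1 / 2.
    have : A * K * expR (- beta) @[beta --> +oo] --> A * K * 0.
      by apply: cvgM; [exact: cvg_cst|exact: cvgr_expR].
    rewrite mulr0 => /cvgr_le; apply; lra.
  near=> beta.
  have b0 : 0 <= beta by near: beta; exact: nbhs_pinfty_ge.
  have small : A * K * expR (- beta) <= 1 / 2 by near: beta.
  apply/andP; split.
    (* A supremum is nonnegative here because some list is not null. *)
    have [j _] := ex_dominant (null_list hN).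
    apply: (@le_trans _ _ (P beta (move j (null_list hN)) [set w |
      ((expR (- beta * (1 - delta)))%:E <
       hitting_time (U beta (move j (null_list hN))) (ladder hN) w)%E])).
      exact: measure_ge0.
    apply: ereal_sup_ubound; exists (move j (null_list hN)) => //=.
    exact: move_null_neq_null.
  apply: ge_ereal_sup => _ [u /= u0 <-].
  exact: (hitting_ladder_tail b0 small (proc _ _ b0) u0).
- exact: cvg_cst.
- apply/cvg_EFin; first by apply: nearW.
  rewrite -(mulr0 (2 * A * K)).
  have betadelta : beta * delta @[beta --> +oo] --> +oo.
    apply/cvgryPge => b; exists (b / delta); split; first exact: num_real.
    by move=> beta; rewrite ltr_pdivrMr// => /ltW.
  apply: cvgM; first exact: cvg_cst.
  have h := cvg_comp (fun b => b * delta) (fun y => expR (- y)) betadelta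
    (@cvgr_expR R).
  exact: h.
Unshelve. all: by end_near.
Qed.
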